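(* Let $h\colon S\to R$ be a flat ring homomorphism and $M$ a coherent $R$-module. Suppose $R$ is coherent, $S$ is noetherian and $n>1$. (i) There exists a complex $E$ of finite projective $R$-modules which is a hull for $M$ such that: if $M$ is $n$-stably reflexive with respect to $h$, then so is $E$. (ii) Let $E$ be an $n$-stably reflexive complex with respect to $h$ and a hull for $M$. Then: (a) The $R$-module $M$ is $n$-stably reflexive with respect to $h$. (b) For any ring homomorphism $S\to S'$ the base change $E'=E\otimes_S S'$ is $n$-stably reflexive with respect to $h'=h\otimes_S S'\colon S'\to R'=R\otimes_S S'$ and as an $R'$-complex, and $E'$ is a hull for $M'=M\otimes_S S'$.
   Context: All rings are commutative and unital. A module is coherent if it is finitely generated and all its finitely generated submodules are finitely presented; a ring is coherent if it is coherent as a module over itself. For a ring $A$ and an $A$-module $M$ put $M^*=\operatorname{Hom}_A(M,A)$; $M$ is reflexive if the evaluation map $M\to M^{**}$ is an isomorphism. For a positive integer $n$, $M$ is $n$-stably reflexive if $M$ is reflexive and $\operatorname{Ext}^i_A(M,A)=0=\operatorname{Ext}^i_A(M^*,A)$ for all $0<i<n$. Let $E\colon\dots\to E^{-1}\xrightarrow{d^{-1}}E^0\xrightarrow{d^0}E^1\to\dots$ be a cochain complex of finite projective $A$-modules. Its (non-standard) dual complex $E^\vee$ has $(E^\vee)^i=(E^{1-i})^*$ with differential $d^i_{E^\vee}=(d_E^{-i})^*\colon (E^{1-i})^*\to(E^{-i})^*$. If $M\cong\operatorname{coker}(d^{-1}\colon E^{-1}\to E^0)$, then $E$ is called a hull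 for $M$. $E$ is an $n$-stably reflexive $A$-complex if $H^i(E)=0=H^i(E^\vee)$ for all $i\le n$. Let $h\colon S\to R$ be a flat ring homomorphism and let $Z\subseteq\operatorname{Spec}S$ be the image of the set of closed points of $\operatorname{Spec}R$. For $s\in Z$ with residue field $k(s)$ write $(-)_s$ for $-\otimes_Sk(s)$. An $R$-module $M$ is $n$-stably reflexive with respect to $h$ if $M$ is $S$-flat and $M_s$ is an $n$-stably reflexive $R_s$-module for all $s\in Z$. A complex $E$ of finite projective $R$-modules is $n$-stably reflexive with respect to $h$ if $E_s$ is an $n$-stably reflexive $R_s$-complex for all $s\in Z$. *)

(* Defs.v *)
From HB Require Import structures.
From mathcomp Require Import all_boot all_order all_algebra generic_quotient.
From mathcomp Require Import boolp classical_sets.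
From mathcomp Require Import ring.

Set Implicit Arguments.
Unset Strict Implicit.
Unset Printing Implicit Defensive.

Import GRing.Theory.
Local Open Scope ring_scope.
Local Open Scope quotient_scope.

(* Rings are comPzRingType's: the zero ring is allowed, e.g. R ⊗_S S' may
   vanish.  A quotient of a choice type by a Prop-valued equivalence relation
   is {eq_quot _} of the boolean relation obtained from it by `[< _ >]. *)

Section Hom.
Variables (A : comPzRingType) (M N : lmodType A).

Definition hom : Type := {linear M -> N}.

HB.instance Definition _ := gen_eqMixin hom.
HB.instance Definition _ := gen_choiceMixin hom.

Definition hom_fun (f : hom) : {linear M -> N} := f.
Coercion hom_fun : hom >-> GRing.Linear.type.

Lemma homP (f g : hom) : (forall x, f x = g x) -> f = g.
Proof.
case: f g => [f cf] [g cg] /= /funext efg.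
case: _ / efg cg => -[[cg1] [cg2]]; case: cf => -[cf1] [cf2].
by rewrite (Prop_irrelevance cf1 cg1) (Prop_irrelevance cf2 cg2).
Qed.

Definition hom0 : hom := (\0 : {linear M -> N}).
Definition homN (f : hom) : hom := (\- f : {linear M -> N}).
Definition homD (f g : hom) : hom := (f \+ g : {linear M -> N}).
Definition homZ (a : A) (f : hom) : hom := (a \*: f : {linear M -> N}).

Fact homDA : associative homD.
Proof. by move=> f g k; apply: homP => x; rewrite /= addrA. Qed.
Fact homDC : commutative homD.
Proof. by move=> f g; apply: homP => x; rewrite /= addrC. Qed.
Fact hom0D : left_id hom0 homD.
Proof. by move=> f; apply: homP => x; rewrite /= add0r. Qed.
Fact homND : left_inverse hom0 homN homD.
Proof. by move=> f; apply: homP => x; rewrite /= addNr. Qed.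

HB.instance Definition _ := GRing.isZmodule.Build hom homDA homDC hom0D homND.

Fact homZA a b f : homZ a (homZ b f) = homZ (a * b) f.
Proof. by apply: homP => x; rewrite /= scalerA. Qed.
Fact hom1Z : left_id 1 homZ.
Proof. by move=> f; apply: homP => x; rewrite /= scale1r. Qed.
Fact homZDr : right_distributive homZ +%R.
Proof. by move=> a f g; apply: homP => x; rewrite /= scalerDr. Qed.
Fact homZDl f : {morph homZ^~ f : a b / a + b}.
Proof. by move=> a b; apply: homP => x; rewrite /= scalerDl. Qed.

HB.instance Definition _ :=
  GRing.Zmodule_isLmodule.Build A hom homZA hom1Z homZDr homZDl.

End Hom.

Section Dual.
Variable A : comPzRingType.

Definition dual (M : lmodType A) : lmodType A := hom M A^o.

Section Transpose.
Variables (M N : lmodType A) (f : {linear M -> N}).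
Definition transpose_fun (phi : dual N) : dual M :=
  (hom_fun phi \o f : {linear M -> A^o}).
Fact transpose_linear : linear transpose_fun.
Proof. by move=> a phi psi; apply: homP. Qed.
HB.instance Definition _ :=
  GRing.isLinear.Build A (dual N) (dual M) *:%R transpose_fun transpose_linear.
Definition transpose : {linear dual N -> dual M} := transpose_fun.
End Transpose.

Section Evaluation.
Variable M : lmodType A.
Definition ev_at (x : M) (phi : dual M) : A^o := hom_fun phi x.
Fact ev_at_linear x : linear (ev_at x).
Proof. by []. Qed.
HB.instance Definition _ x :=
  GRing.isLinear.Build A (dual M) A^o *:%R (ev_at x) (ev_at_linear x).
Definition bidual_fun (x : M) : dual (dual M) := (ev_at x : {linear _ -> A^o}).
Fact bidual_linear : linear bidual_fun.
Proof.
by move=> a x y; apply: homP => phi; rewrite /= /ev_at linearP.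
Qed.
HB.instance Definition _ :=
  GRing.isLinear.Build A M (dual (dual M)) *:%R bidual_fun bidual_linear.
Definition bidual : {linear M -> dual (dual M)} := bidual_fun.
End Evaluation.

Definition reflexive_module (M : lmodType A) : Prop := bijective (bidual M).

End Dual.

Section Finiteness.
Variable A : comPzRingType.

Definition surjective (T U : Type) (f : T -> U) : Prop :=
  forall y, exists x, f x = y.

Definition fin_gen (M : lmodType A) : Prop :=
  exists (n : nat) (p : {linear 'rV[A]_n -> M}), surjective p.

Definition fin_pres (M : lmodType A) : Prop :=
  exists (m n : nat) (f : {linear 'rV[A]_m -> 'rV[A]_n})
    (p : {linear 'rV[A]_n -> M}),
    surjective p /\ (forall x, p x = 0 <-> exists y, f y = x).

(* Submodules are given, up to isomorphism, by injective linear maps. *)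
Definition coherent (M : lmodType A) : Prop :=
  fin_gen M /\
  forall (N : lmodType A) (i : {linear N -> M}),
    injective i -> fin_gen N -> fin_pres N.

Definition projective (P : lmodType A) : Prop :=
  forall (X Y : lmodType A) (q : {linear X -> Y}) (f : {linear P -> Y}),
    surjective q -> exists l : {linear P -> X}, forall x, q (l x) = f x.

Definition fin_proj (P : lmodType A) : Prop := fin_gen P /\ projective P.

Definition is_ideal (I : set A) : Prop :=
  [/\ I 0, (forall x y, I x -> I y -> I (x + y))
    & (forall a x, I x -> I (a * x))].

End Finiteness.

Definition coherent_ring (A : comPzRingType) : Prop := @coherent A A^o.

Definition noetherian (A : comPzRingType) : Prop :=
  forall I : set A, is_ideal I ->
  exists (n : nat) (g : 'I_n -> A),
    forall x, I x <-> exists c : 'I_n -> A, x = \sum_(i < n) c i * g i.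

Section Ext.
Variable A : comPzRingType.

Record proj_resolution (M : lmodType A) := ProjResolution {
  res_obj : nat -> lmodType A;
  res_d : forall i, {linear res_obj i.+1 -> res_obj i};
  res_aug : {linear res_obj 0%N -> M};
  res_proj : forall i, projective (res_obj i);
  res_aug_surj : surjective res_aug;
  res_exact0 : forall x, res_aug x = 0 <-> exists y, res_d 0%N y = x;
  res_exact : forall i x, res_d i x = 0 <-> exists y, res_d i.+1 y = x
}.

(* Vanishing of the i-th cohomology of the complex Hom_A(P, N). *)
Definition hom_acyclic_at (M N : lmodType A) (P : proj_resolution M) (i : nat) :
    Prop :=
  forall phi : {linear res_obj P i -> N}, (forall x, phi (res_d P i x) = 0) ->
  match i return {linear res_obj P i -> N} -> Prop with
  | 0 => fun phi => forall x, phi x = 0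
  | j.+1 => fun phi => exists psi : {linear res_obj P j -> N},
                        forall x, psi (res_d P j x) = phi x
  end phi.

(* Ext^i_A(M, N) = 0.  Every module has a projective resolution and Ext does
   not depend on its choice, so "every" may equivalently be read as "some". *)
Definition Ext_eq0 (i : nat) (M N : lmodType A) : Prop :=
  forall P : proj_resolution M, hom_acyclic_at N P i.

Definition stably_reflexive (n : nat) (M : lmodType A) : Prop :=
  reflexive_module M /\
  forall i : nat, (0 < i < n)%N ->
    Ext_eq0 i M A^o /\ Ext_eq0 i (dual M) A^o.

End Ext.

Section Cokernel.
Variables (A : comPzRingType) (U V : lmodType A) (f : {linear U -> V}).

Definition coker_rel (x y : V) : bool := `[< exists u, f u = x - y >].

Fact coker_rel_refl : ssrbool.reflexive coker_rel.
Proof. by move=> x; apply/asboolP; exists 0; rewrite linear0 subrr. Qed.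
Fact coker_rel_sym : ssrbool.symmetric coker_rel.
Proof.
by move=> x y; apply/asboolP/asboolP => -[u fu]; exists (- u);
  rewrite linearN fu opprB.
Qed.
Fact coker_rel_trans : ssrbool.transitive coker_rel.
Proof.
move=> y x z /asboolP[u fu] /asboolP[v fv]; apply/asboolP; exists (u + v).
by rewrite linearD fu fv addrA subrK.
Qed.
Canonical coker_equiv :=
  EquivRel coker_rel coker_rel_refl coker_rel_sym coker_rel_trans.

Definition coker := {eq_quot coker_rel}.
HB.instance Definition _ : EqQuotient _ coker_rel coker := EqQuotient.on coker.
HB.instance Definition _ := Choice.on coker.

Lemma coker_eqP (x y : V) :
  reflect (exists u, f u = x - y) (\pi_coker x == \pi_coker y).
Proof. by rewrite eqmodE; exact: asboolP. Qed.

Definition coker0 : coker := \pi_coker 0.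
Definition cokerD (a b : coker) : coker := \pi_coker (repr a + repr b).
Definition cokerN (a : coker) : coker := \pi_coker (- repr a).
Definition cokerZ (c : A) (a : coker) : coker := \pi_coker (c *: repr a).

Lemma coker_repr x : exists u, f u = repr (\pi_coker x) - x.
Proof. by apply/coker_eqP; rewrite reprK. Qed.

Lemma cokerD_pi x y : cokerD (\pi x) (\pi y) = \pi_coker (x + y).
Proof.
have [[u fu] [v fv]] := (coker_repr x, coker_repr y).
by apply/eqP/coker_eqP; exists (u + v); rewrite linearD fu fv opprD addrACA.
Qed.
Lemma cokerN_pi x : cokerN (\pi x) = \pi_coker (- x).
Proof.
have [u fu] := coker_repr x.
by apply/eqP/coker_eqP; exists (- u); rewrite linearN fu opprD.
Qed.
Lemma cokerZ_pi c x : cokerZ c (\pi x) = \pi_coker (c *: x).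
Proof.
have [u fu] := coker_repr x.
by apply/eqP/coker_eqP; exists (c *: u); rewrite linearZ /= fu scalerBr.
Qed.

Fact cokerDA : associative cokerD.
Proof.
by elim/quotW=> x; elim/quotW=> y; elim/quotW=> z; rewrite !cokerD_pi addrA.
Qed.
Fact cokerDC : commutative cokerD.
Proof. by elim/quotW=> x; elim/quotW=> y; rewrite !cokerD_pi addrC. Qed.
Fact coker0D : left_id coker0 cokerD.
Proof. by elim/quotW=> x; rewrite cokerD_pi add0r. Qed.
Fact cokerND : left_inverse coker0 cokerN cokerD.
Proof. by elim/quotW=> x; rewrite cokerN_pi cokerD_pi addNr. Qed.

HB.instance Definition _ :=
  GRing.isZmodule.Build coker cokerDA cokerDC coker0D cokerND.

Fact cokerZA a b v : cokerZ a (cokerZ b v) = cokerZ (a * b) v.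
Proof. by elim/quotW: v => x; rewrite !cokerZ_pi scalerA. Qed.
Fact coker1Z : left_id 1 cokerZ.
Proof. by elim/quotW=> x; rewrite cokerZ_pi scale1r. Qed.
Fact cokerZDr : right_distributive cokerZ +%R.
Proof.
move=> c; elim/quotW=> x; elim/quotW=> y.
rewrite -[RHS]/(cokerD _ _) -[LHS]/(cokerZ c (cokerD _ _)).
by rewrite cokerD_pi !cokerZ_pi cokerD_pi scalerDr.
Qed.
Fact cokerZDl v : {morph cokerZ^~ v : a b / a + b}.
Proof.
move=> a b; elim/quotW: v => x.
by rewrite -[RHS]/(cokerD _ _) !cokerZ_pi cokerD_pi scalerDl.
Qed.

HB.instance Definition _ :=
  GRing.Zmodule_isLmodule.Build A coker cokerZA coker1Z cokerZDr cokerZDl.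

End Cokernel.

(* The differentials are indexed by pairs (i, j) and vanish unless j = i + 1;
   this avoids transporting along equations such as 1 - (i + 1) = - i. *)
Record cochain_complex (A : comPzRingType) := CochainComplex {
  cobj : int -> lmodType A;
  cdiff : forall i j, {linear cobj i -> cobj j};
  cdiff_shape : forall i j, j != i + 1 -> forall x, cdiff i j x = 0;
  cdiff_sq : forall i j k x, cdiff j k (cdiff i j x) = 0
}.

Section Complexes.
Variable A : comPzRingType.

Section DualComplex.
Variable E : cochain_complex A.
Definition dual_diff (i j : int) :
    {linear dual (cobj E (1 - i)) -> dual (cobj E (1 - j))} :=
  transpose (cdiff E (1 - j) (1 - i)).
Fact dual_shape i j : j != i + 1 -> forall phi, dual_diff i j phi = 0.
Proof.
move=> ne phi; apply: homP => x /=; rewrite cdiff_shape ?linear0 //.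
apply: contra ne => /eqP e; apply/eqP/(addrI (1 - j)).
by rewrite subrK (addrC i) addrA -e subrK.
Qed.
Fact dual_sq i j k phi : dual_diff j k (dual_diff i j phi) = 0.
Proof. by apply: homP => x /=; rewrite cdiff_sq linear0. Qed.
Definition dual_complex : cochain_complex A := CochainComplex dual_shape dual_sq.
End DualComplex.

Definition cohomology_eq0 (E : cochain_complex A) (i : int) : Prop :=
  forall x, cdiff E i (i + 1) x = 0 -> exists y, cdiff E (i - 1) i y = x.

Definition fin_proj_complex (E : cochain_complex A) : Prop :=
  forall i, fin_proj (cobj E i).

Definition hull (E : cochain_complex A) (M : lmodType A) : Prop :=
  fin_proj_complex E /\
  exists phi : {linear coker (cdiff E (-1) 0) -> M}, bijective phi.

Definition stably_reflexive_complex (n : nat) (E : cochain_complex A) : Prop :=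
  fin_proj_complex E /\
  forall i : int, i <= n%:Z ->
    cohomology_eq0 E i /\ cohomology_eq0 (dual_complex E) i.

End Complexes.

(* M ⊗_S N for an R-module M and an R'-module N regarded as S-modules through
   h : S -> R and g : S -> R': formal sums of pairs (m, n) modulo the congruence
   generated by the tensor relations.  Negatives are not needed among the
   formal sums, since - (m ⊗ n) = (- m) ⊗ n. *)
Section Tensor.
Variables (S R R' : comPzRingType).
Variables (h : {rmorphism S -> R}) (g : {rmorphism S -> R'}).

Section Module.
Variables (M : lmodType R) (N : lmodType R').

Inductive tens_eq : seq (M * N) -> seq (M * N) -> Prop :=
| tens_eq_refl l : tens_eq l l
| tens_eq_sym l1 l2 : tens_eq l1 l2 -> tens_eq l2 l1
| tens_eq_trans l1 l2 l3 : tens_eq l1 l2 -> tens_eq l2 l3 -> tens_eq l1 l3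
| tens_eq_cat l1 l2 k1 k2 :
    tens_eq l1 l2 -> tens_eq k1 k2 -> tens_eq (l1 ++ k1) (l2 ++ k2)
| tens_eq_catC l1 l2 : tens_eq (l1 ++ l2) (l2 ++ l1)
| tens_eq_Dl m m' n : tens_eq [:: (m + m', n)] [:: (m, n); (m', n)]
| tens_eq_Dr m n n' : tens_eq [:: (m, n + n')] [:: (m, n); (m, n')]
| tens_eq_0 n : tens_eq [:: (0, n)] [::]
| tens_eq_Z s m n : tens_eq [:: (h s *: m, n)] [:: (m, g s *: n)].

Definition tens_rel (l1 l2 : seq (M * N)) : bool := `[< tens_eq l1 l2 >].

Fact tens_rel_refl : ssrbool.reflexive tens_rel.
Proof. by move=> l; apply/asboolP; constructor. Qed.
Fact tens_rel_sym : ssrbool.symmetric tens_rel.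
Proof. by move=> l k; apply/asboolP/asboolP => ?; constructor. Qed.
Fact tens_rel_trans : ssrbool.transitive tens_rel.
Proof.
move=> k l m /asboolP lk /asboolP km; apply/asboolP; exact: tens_eq_trans lk km.
Qed.
Canonical tens_equiv :=
  EquivRel tens_rel tens_rel_refl tens_rel_sym tens_rel_trans.

Definition tens := {eq_quot tens_rel}.
HB.instance Definition _ : EqQuotient _ tens_rel tens := EqQuotient.on tens.
HB.instance Definition _ := Choice.on tens.

Lemma tensP (l k : seq (M * N)) : \pi_tens l = \pi_tens k <-> tens_eq l k.
Proof.
by split=> [/eqP|lk]; [|apply/eqP]; rewrite eqmodE; [move/asboolP|apply/asboolP].
Qed.

Lemma tens_repr l : tens_eq (repr (\pi_tens l)) l.
Proof. by apply/tensP; rewrite reprK. Qed.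

Definition tens0 : tens := \pi_tens [::].
Definition tensD (a b : tens) : tens := \pi_tens (repr a ++ repr b).
Definition negl (l : seq (M * N)) := [seq (- x.1, x.2) | x <- l].
Definition tensN (a : tens) : tens := \pi_tens (negl (repr a)).

Lemma tens_eq_negl l k : tens_eq l k -> tens_eq (negl l) (negl k).
Proof.
rewrite /negl; elim=> {l k} => [l|l k _|l k m _ lk _|l1 l2 k1 k2 _ l12 _|l k|m m' n|
  m n n'|n|s m n] //=; rewrite ?map_cat ?oppr0 -?scalerN ?opprD; try by constructor.
exact: tens_eq_trans.
Qed.

Lemma tens_eq_negK l : tens_eq (negl l ++ l) [::].
Proof.
elim: l => [|[m n] l IHl] /=; first by constructor.
have mnK : tens_eq [:: (- m, n); (m, n)] [::].
  apply: tens_eq_trans (tens_eq_0 n); rewrite -(addNr m).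
  by apply: tens_eq_sym; constructor.
apply: tens_eq_trans (tens_eq_cat mnK IHl).
apply: (@tens_eq_cat [:: _] [:: _] _ ((m, n) :: _)); first by constructor.
rewrite -[_ :: l]cat1s -[_ :: _ ++ _]cat1s !catA.
by apply: tens_eq_cat; constructor.
Qed.

Lemma tensD_pi l k : tensD (\pi l) (\pi k) = \pi_tens (l ++ k).
Proof. by apply/tensP/tens_eq_cat; exact: tens_repr. Qed.
Lemma tensN_pi l : tensN (\pi l) = \pi_tens (negl l).
Proof. by apply/tensP/tens_eq_negl; exact: tens_repr. Qed.

Fact tensDA : associative tensD.
Proof.
by elim/quotW=> x; elim/quotW=> y; elim/quotW=> z; rewrite !tensD_pi catA.
Qed.
Fact tensDC : commutative tensD.
Proof.
elim/quotW=> x; elim/quotW=> y; rewrite !tensD_pi.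
by apply/tensP; constructor.
Qed.
Fact tens0D : left_id tens0 tensD.
Proof. by elim/quotW=> x; rewrite tensD_pi. Qed.
Fact tensND : left_inverse tens0 tensN tensD.
Proof.
by elim/quotW=> x; rewrite tensN_pi tensD_pi; apply/tensP/tens_eq_negK.
Qed.

HB.instance Definition _ :=
  GRing.isZmodule.Build tens tensDA tensDC tens0D tensND.

Definition pure (m : M) (n : N) : tens := \pi_tens [:: (m, n)].

Lemma pureDl m m' n : pure (m + m') n = pure m n + pure m' n.
Proof. by rewrite [RHS]tensD_pi; apply/tensP; constructor. Qed.
Lemma pureDr m n n' : pure m (n + n') = pure m n + pure m n'.
Proof. by rewrite [RHS]tensD_pi; apply/tensP; constructor. Qed.
Lemma pure0l n : pure 0 n = 0.
Proof. by apply/tensP; constructor. Qed.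
Lemma pureZ s m n : pure (h s *: m) n = pure m (g s *: n).
Proof. by apply/tensP; constructor. Qed.
Lemma pure0r m : pure m 0 = 0.
Proof. by rewrite -(scale0r (0 : N)) -(rmorph0 g) -pureZ rmorph0 scale0r pure0l. Qed.

Lemma pi_sum l : \pi_tens l = \sum_(x <- l) pure x.1 x.2.
Proof.
elim: l => [|[m n] l IHl]; first by rewrite big_nil.
by rewrite big_cons -IHl [RHS]tensD_pi.
Qed.

Lemma tens_ind (P : tens -> Prop) :
  P 0 -> (forall a b, P a -> P b -> P (a + b)) -> (forall m n, P (pure m n)) ->
  forall a, P a.
Proof.
move=> P0 PD Pp; elim/quotW=> l; rewrite pi_sum.
by apply: (big_ind P) => // -[m n] _; exact: Pp.
Qed.

Section Lift.
Variables (W : zmodType) (b : M -> N -> W).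
Hypothesis bDl : forall m m' n, b (m + m') n = b m n + b m' n.
Hypothesis bDr : forall m n n', b m (n + n') = b m n + b m n'.
Hypothesis bZ : forall s m n, b (h s *: m) n = b m (g s *: n).

Definition tens_lift (a : tens) : W := \sum_(x <- repr a) b x.1 x.2.

Lemma tens_eq_lift l k : tens_eq l k ->
  \sum_(x <- l) b x.1 x.2 = \sum_(x <- k) b x.1 x.2.
Proof.
elim=> {l k} => [//|l k _ ->//|l k m _ -> _ ->//|l1 l2 k1 k2 _ l12 _ k12|l k|
    m m' n|m n n'|n|s m n];
  rewrite ?big_cat ?big_cons ?big_nil /= ?addr0 ?l12 ?k12 //.
- exact: addrC.
- by apply: (addrI (b 0 n)); rewrite -bDl !addr0.
Qed.

Lemma tens_lift_pi l : tens_lift (\pi_tens l) = \sum_(x <- l) b x.1 x.2.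
Proof. exact: tens_eq_lift (tens_repr l). Qed.

Lemma tens_lift_pure m n : tens_lift (pure m n) = b m n.
Proof. by rewrite tens_lift_pi big_seq1. Qed.

Lemma tens_liftD : {morph tens_lift : x y / x + y}.
Proof.
elim/quotW=> x; elim/quotW=> y.
rewrite -[LHS]/(tens_lift (tensD _ _)) tensD_pi.
by rewrite -[X in _ = X + _]/(tens_lift (\pi_tens x)) !tens_lift_pi big_cat.
Qed.

End Lift.

End Module.

(* (r ⊗ r') acts on M ⊗_S N by m ⊗ n |-> r m ⊗ r' n. *)
Section Action.
Variables (M : lmodType R) (N : lmodType R').
Local Notation T := (tens R^o R'^o).

Definition act_pure (r : R) (r' : R') : tens M N -> tens M N :=
  tens_lift (fun m n => pure (r *: m) (r' *: n)).

Definition act (a : T) (x : tens M N) : tens M N :=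
  tens_lift (fun (r : R^o) (r' : R'^o) => act_pure r r' x) a.

Lemma act_pureD r r' : {morph act_pure r r' : x y / x + y}.
Proof.
apply: tens_liftD => [m m' n|m n n'|s m n].
- by rewrite scalerDr pureDl.
- by rewrite scalerDr pureDr.
- by rewrite scalerA mulrC -scalerA pureZ !scalerA mulrC.
Qed.

Lemma act_pureE r r' m n : act_pure r r' (pure m n) = pure (r *: m) (r' *: n).
Proof.
apply: tens_lift_pure => [{}m m' {}n|{}m {}n n'|s {}m {}n].
- by rewrite scalerDr pureDl.
- by rewrite scalerDr pureDr.
- by rewrite scalerA mulrC -scalerA pureZ !scalerA mulrC.
Qed.

Lemma act_pure0 r r' : act_pure r r' 0 = 0.
Proof. by apply: (addrI (act_pure r r' 0)); rewrite -act_pureD !addr0. Qed.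

Let bil (x : tens M N) :
  [/\ forall r1 r2 r', act_pure (r1 + r2) r' x = act_pure r1 r' x + act_pure r2 r' x,
      forall r r1 r2, act_pure r (r1 + r2) x = act_pure r r1 x + act_pure r r2 x
    & forall s r r', act_pure (h s * r) r' x = act_pure r (g s * r') x].
Proof.
split=> [r1 r2 r'|r r1 r2|s r r']; elim/tens_ind: x => [|x y Hx Hy|m n];
  rewrite ?act_pure0 ?addr0 ?act_pureD ?Hx ?Hy ?act_pureE //.
- by rewrite addrACA.
- by rewrite scalerDl pureDl.
- by rewrite addrACA.
- by rewrite scalerDl pureDr.
- by rewrite -!scalerA pureZ.
Qed.

Lemma actDl a b x : act (a + b) x = act a x + act b x.
Proof. by have [? ? ?] := bil x; rewrite /act tens_liftD. Qed.

Lemma act0l x : act 0 x = 0.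
Proof. by apply: (addrI (act 0 x)); rewrite -actDl !addr0. Qed.

Lemma act_pureEl r r' x : act (pure (r : R^o) (r' : R'^o)) x = act_pure r r' x.
Proof. by have [? ? ?] := bil x; rewrite /act tens_lift_pure. Qed.

Lemma actE r r' m n :
  act (pure (r : R^o) (r' : R'^o)) (pure m n) = pure (r *: m) (r' *: n).
Proof. by rewrite act_pureEl act_pureE. Qed.

Lemma actDr a x y : act a (x + y) = act a x + act a y.
Proof.
elim/tens_ind: a => [|a b Ha Hb|r r'].
- by rewrite !act0l addr0.
- by rewrite !actDl Ha Hb addrACA.
- by rewrite !act_pureEl act_pureD.
Qed.

Lemma act0r a : act a 0 = 0.
Proof. by apply: (addrI (act a 0)); rewrite -actDr !addr0. Qed.

End Action.

Definition tens_alg := tens R^o R'^o.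
HB.instance Definition _ := GRing.Zmodule.on tens_alg.

Definition tens_one : tens_alg := pure (1 : R^o) (1 : R'^o).
Definition tens_mul (a b : tens_alg) : tens_alg := act a b.

Fact act_mul M N a b (x : tens M N) : act a (act b x) = act (tens_mul a b) x.
Proof.
elim/tens_ind: a => [|a a' Ha Ha'|r r'].
- by rewrite /tens_mul !act0l.
- by rewrite /tens_mul !actDl Ha Ha'.
elim/tens_ind: b => [|b b' Hb Hb'|t t'].
- by rewrite /tens_mul act0l !act0r act0l.
- by rewrite actDl actDr Hb Hb' /tens_mul actDr actDl.
elim/tens_ind: x => [|x x' Hx Hx'|m n].
- by rewrite !act0r.
- by rewrite !actDr Hx Hx'.
- by rewrite /tens_mul !actE !scalerA.
Qed.

Fact act1 M N (x : tens M N) : act tens_one x = x.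
Proof.
elim/tens_ind: x => [|x x' Hx Hx'|m n].
- by rewrite !act0r.
- by rewrite !actDr Hx Hx'.
- by rewrite actE !scale1r.
Qed.

Fact tens_mulA : associative tens_mul.
Proof. by move=> a b c; rewrite {1 2}/tens_mul act_mul. Qed.
Fact tens_mulC : commutative tens_mul.
Proof.
rewrite /tens_mul => a b; elim/tens_ind: a => [|a a' Ha Ha'|r r'].
- by rewrite act0l act0r.
- by rewrite actDl actDr Ha Ha'.
elim/tens_ind: b => [|b b' Hb Hb'|t t'].
- by rewrite act0l act0r.
- by rewrite actDl actDr Hb Hb'.
- by rewrite !actE; congr pure; exact: mulrC.
Qed.
Fact tens_mul1 : left_id tens_one tens_mul.
Proof. exact: act1. Qed.
Fact tens_mulDl : left_distributive tens_mul +%R.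
Proof. by move=> a b c; exact: actDl. Qed.

HB.instance Definition _ := GRing.Zmodule_isComPzRing.Build tens_alg
  tens_mulA tens_mulC tens_mul1 tens_mulDl.

Definition base_ring : comPzRingType := tens_alg.

Section BaseModule.
Variables (M : lmodType R) (N : lmodType R').

Fact act_scaleDr : right_distributive (@act M N) +%R.
Proof. by move=> a x y; exact: actDr. Qed.
Fact act_scaleDl (x : tens M N) : {morph (@act M N)^~ x : a b / a + b}.
Proof. by move=> a b; exact: actDl. Qed.

HB.instance Definition _ := GRing.Zmodule_isLmodule.Build base_ring (tens M N)
  (@act_mul M N) (@act1 M N) act_scaleDr act_scaleDl.

Definition tensor : lmodType base_ring := tens M N.
End BaseModule.

Definition base_hom_fun (r' : R') : base_ring := pure (1 : R^o) (r' : R'^o).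

Fact base_hom_zmod : zmod_morphism base_hom_fun.
Proof.
move=> x y; apply/eqP; rewrite eq_sym subr_eq; apply/eqP.
by rewrite -[RHS]pureDr subrK.
Qed.
Fact base_hom_monoid : monoid_morphism base_hom_fun.
Proof.
split=> // x y; rewrite -[RHS]/(act _ _) actE.
by congr pure; rewrite /GRing.scale /= mulr1.
Qed.
HB.instance Definition _ :=
  GRing.isZmodMorphism.Build R' base_ring base_hom_fun base_hom_zmod.
HB.instance Definition _ :=
  GRing.isMonoidMorphism.Build R' base_ring base_hom_fun base_hom_monoid.

(* The base change R' -> R ⊗_S R' of h along g. *)
Definition base_hom : {rmorphism R' -> base_ring} := base_hom_fun.

Section TensorMap.
Variables (M M1 : lmodType R) (N N1 : lmodType R').
Variables (f : {linear M -> M1}) (k : {linear N -> N1}).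

Definition tensor_map_fun : tensor M N -> tensor M1 N1 :=
  tens_lift (fun m n => pure (f m) (k n)).

Let bil :
  [/\ forall m m' n, pure (f (m + m')) (k n) = pure (f m) (k n) + pure (f m') (k n),
      forall m n n', pure (f m) (k (n + n')) = pure (f m) (k n) + pure (f m) (k n')
    & forall s m n, pure (f (h s *: m)) (k n) = pure (f m) (k (g s *: n))].
Proof.
split=> [m m' n|m n n'|s m n]; rewrite ?linearD ?linearZ /=.
- exact: pureDl.
- exact: pureDr.
- exact: pureZ.
Qed.

Lemma tensor_map_pure m n : tensor_map_fun (pure m n) = pure (f m) (k n).
Proof. by have [? ? ?] := bil; rewrite /tensor_map_fun tens_lift_pure. Qed.

Lemma tensor_mapD : {morph tensor_map_fun : x y / x + y}.
Proof. by have [? ? ?] := bil; apply: tens_liftD. Qed.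

Fact tensor_map_linear : linear tensor_map_fun.
Proof.
have map0 : tensor_map_fun 0 = 0.
  by apply: (addrI (tensor_map_fun 0)); rewrite -tensor_mapD !addr0.
move=> a x y; rewrite tensor_mapD; congr (_ + _).
elim/tens_ind: a => [|a b Ha Hb|r r'].
- by rewrite !scale0r map0.
- by rewrite !scalerDl tensor_mapD Ha Hb.
elim/tens_ind: x => [|x x' Hx Hx'|m n].
- by rewrite map0 !scaler0 map0.
- by rewrite scalerDr tensor_mapD Hx Hx' -scalerDr tensor_mapD.
rewrite -[LHS]/(tensor_map_fun (act (pure (r : R^o) (r' : R'^o)) (pure m n))).
by rewrite actE !tensor_map_pure !linearZ /= -[RHS]/(act _ _) actE.
Qed.
HB.instance Definition _ := GRing.isLinear.Build base_ring
  (tensor M N) (tensor M1 N1) *:%R tensor_map_fun tensor_map_linear.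

Definition tensor_map : {linear tensor M N -> tensor M1 N1} := tensor_map_fun.
End TensorMap.

Definition base_module (M : lmodType R) : lmodType base_ring := tensor M R'^o.

Section BaseComplex.
Variable E : cochain_complex R.

Definition base_diff i j :
    {linear base_module (cobj E i) -> base_module (cobj E j)} :=
  tensor_map (cdiff E i j) (idfun : {linear R'^o -> R'^o}).

Fact base_shape i j : j != i + 1 -> forall x, base_diff i j x = 0.
Proof.
move=> ne x; elim/tens_ind: x => [|x y Hx Hy|m n].
- exact: linear0.
- by rewrite linearD Hx Hy addr0.
- by rewrite [LHS]tensor_map_pure cdiff_shape // pure0l.
Qed.
Fact base_sq i j l x : base_diff j l (base_diff i j x) = 0.
Proof.
elim/tens_ind: x => [|x y Hx Hy|m n].
- by rewrite !linear0.
- by rewrite !linearD Hx Hy addr0.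
- rewrite [X in base_diff j l X]tensor_map_pure [LHS]tensor_map_pure.
  by rewrite cdiff_sq pure0l.
Qed.

Definition base_complex : cochain_complex base_ring :=
  CochainComplex base_shape base_sq.
End BaseComplex.

End Tensor.

Section Flat.
Variables (S R : comPzRingType) (h : {rmorphism S -> R}).

(* M, regarded as an S-module through h, is S-flat. *)
Definition flat_over (M : lmodType R) : Prop :=
  forall (N N1 : lmodType S) (k : {linear N -> N1}), injective k ->
    injective (tensor_map h (idfun : {rmorphism S -> S})
                          (idfun : {linear M -> M}) k).

Definition flat_hom : Prop := flat_over R^o.
End Flat.

Record Spec (A : comPzRingType) := SpecPoint {
  prime_of :> set A;
  prime_ideal : is_ideal prime_of;
  prime_proper : ~ prime_of 1;
  primeM : forall a b, prime_of (a * b) -> prime_of a \/ prime_of b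
}.

Section ResidueField.
Variables (A : comPzRingType) (p : Spec A).
Local Notation P := (prime_of p).

Lemma prime0 : P 0. Proof. by case: (prime_ideal p). Qed.
Lemma primeD a b : P a -> P b -> P (a + b).
Proof. by case: (prime_ideal p) => _ pD _; exact: pD. Qed.
Lemma primeMl a b : P b -> P (a * b).
Proof. by case: (prime_ideal p) => _ _; exact. Qed.
Lemma primeN a : P a -> P (- a).
Proof. by rewrite -mulN1r; exact: primeMl. Qed.
Lemma primeNM a b : ~ P a -> ~ P b -> ~ P (a * b).
Proof. by move=> pa pb /primeM[]. Qed.

(* k(p) = Frac (A / p): fractions a / b with b not in p, where
   a / b = c / d if and only if a d - c b lies in p. *)
Definition ratio := {x : A * A | `[< ~ P x.2 >]}.

Definition num (x : ratio) : A := (val x).1.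
Definition den (x : ratio) : A := (val x).2.
Lemma denP (x : ratio) : ~ P (den x). Proof. exact/asboolP/(valP x). Qed.
Arguments denP : clear implicits.
Definition mk_ratio (a b : A) (pb : ~ P b) : ratio :=
  exist (fun x : A * A => `[< ~ P x.2 >]) (a, b) (asboolT pb).

Definition ratio_rel (x y : ratio) : bool :=
  `[< P (num x * den y - num y * den x) >].

Fact ratio_rel_refl : ssrbool.reflexive ratio_rel.
Proof. by move=> x; apply/asboolP; rewrite subrr; exact: prime0. Qed.
Fact ratio_rel_sym : ssrbool.symmetric ratio_rel.
Proof. by move=> x y; apply/asboolP/asboolP => /primeN; rewrite opprB. Qed.
Fact ratio_rel_trans : ssrbool.transitive ratio_rel.
Proof.
move=> y x z /asboolP xy /asboolP yz; apply/asboolP.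
suff /primeM[/denP|//] : P (den y * (num x * den z - num z * den x)) by [].
rewrite (_ : _ * _ = den z * (num x * den y - num y * den x) +
                     den x * (num y * den z - num z * den y)); last by ring.
by apply: primeD; exact: primeMl.
Qed.
Canonical ratio_equiv :=
  EquivRel ratio_rel ratio_rel_refl ratio_rel_sym ratio_rel_trans.

Definition residue_field := {eq_quot ratio_rel}.
Local Notation K := residue_field.
HB.instance Definition _ : EqQuotient _ ratio_rel K := EqQuotient.on K.
HB.instance Definition _ := Choice.on K.

Lemma residue_eqP (x y : ratio) :
  \pi_K x = \pi_K y <-> P (num x * den y - num y * den x).
Proof.
split=> [/eqP|xy]; [|apply/eqP]; rewrite eqmodE; first by move/asboolP.
exact/asboolP.
Qed.

Lemma residue_repr x :
  P (num (repr (\pi_K x)) * den x - num x * den (repr (\pi_K x))).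
Proof. by apply/residue_eqP; rewrite reprK. Qed.

Definition ratioD (x y : ratio) : ratio :=
  mk_ratio (num x * den y + num y * den x) (primeNM (denP x) (denP y)).
Definition ratioN (x : ratio) : ratio := mk_ratio (- num x) (denP x).
Definition ratioM (x y : ratio) : ratio :=
  mk_ratio (num x * num y) (primeNM (denP x) (denP y)).
Definition ratioC (a : A) : ratio := mk_ratio a (@prime_proper _ p).

Let ratioE :
  (forall x y, num (ratioD x y) = num x * den y + num y * den x) *
  (forall x y, den (ratioD x y) = den x * den y) *
  (forall x, num (ratioN x) = - num x) * (forall x, den (ratioN x) = den x) *
  (forall x y, num (ratioM x y) = num x * num y) *
  (forall x y, den (ratioM x y) = den x * den y) *
  (forall a, num (ratioC a) = a) * (forall a, den (ratioC a) = 1) *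
  (forall a b (pb : ~ P b), num (mk_ratio a pb) = a) *
  (forall a b (pb : ~ P b), den (mk_ratio a pb) = b).
Proof. by []. Qed.

Definition residueD (x y : K) : K := \pi_K (ratioD (repr x) (repr y)).
Definition residueN (x : K) : K := \pi_K (ratioN (repr x)).
Definition residueM (x y : K) : K := \pi_K (ratioM (repr x) (repr y)).
Definition residue_fun (a : A) : K := \pi_K (ratioC a).

Lemma residueD_pi x y : residueD (\pi x) (\pi y) = \pi_K (ratioD x y).
Proof.
apply/residue_eqP; move: (residue_repr x) (residue_repr y).
move: (repr (\pi_K x)) (repr (\pi_K y)) => x' y' xx yy.
rewrite !ratioE.
rewrite (_ : _ - _ = den y * den y' * (num x' * den x - num x * den x') +
                     den x * den x' * (num y' * den y - num y * den y'));
  last by ring.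
by apply: primeD; exact: primeMl.
Qed.
Lemma residueN_pi x : residueN (\pi x) = \pi_K (ratioN x).
Proof.
apply/residue_eqP; have := residue_repr x; move: (repr _) => x' /primeN xx.
rewrite !ratioE.
by move: xx; rewrite opprD !mulNr.
Qed.
Lemma residueM_pi x y : residueM (\pi x) (\pi y) = \pi_K (ratioM x y).
Proof.
apply/residue_eqP; move: (residue_repr x) (residue_repr y).
move: (repr (\pi_K x)) (repr (\pi_K y)) => x' y' xx yy.
rewrite !ratioE.
rewrite (_ : _ - _ = num y' * den y * (num x' * den x - num x * den x') +
                     num x * den x' * (num y' * den y - num y * den y'));
  last by ring.
by apply: primeD; exact: primeMl.
Qed.

Let ring_eq (x y : ratio) :
  num x * den y - num y * den x = 0 -> \pi_K x = \pi_K y.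
Proof. by move=> e; apply/residue_eqP; rewrite e; exact: prime0. Qed.

Fact residueDA : associative residueD.
Proof.
elim/quotW=> x; elim/quotW=> y; elim/quotW=> z; rewrite !residueD_pi.
by apply: ring_eq; rewrite !ratioE; ring.
Qed.
Fact residueDC : commutative residueD.
Proof.
elim/quotW=> x; elim/quotW=> y; rewrite !residueD_pi.
by apply: ring_eq; rewrite !ratioE; ring.
Qed.
Fact residue0D : left_id (residue_fun 0) residueD.
Proof.
elim/quotW=> x; rewrite residueD_pi.
by apply: ring_eq; rewrite !ratioE; ring.
Qed.
Fact residueND : left_inverse (residue_fun 0) residueN residueD.
Proof.
elim/quotW=> x; rewrite residueN_pi residueD_pi.
by apply: ring_eq; rewrite !ratioE; ring.
Qed.

HB.instance Definition _ :=
  GRing.isZmodule.Build K residueDA residueDC residue0D residueND.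

Fact residueMA : associative residueM.
Proof.
elim/quotW=> x; elim/quotW=> y; elim/quotW=> z; rewrite !residueM_pi.
by apply: ring_eq; rewrite !ratioE; ring.
Qed.
Fact residueMC : commutative residueM.
Proof.
elim/quotW=> x; elim/quotW=> y; rewrite !residueM_pi.
by apply: ring_eq; rewrite !ratioE; ring.
Qed.
Fact residue1M : left_id (residue_fun 1) residueM.
Proof.
elim/quotW=> x; rewrite residueM_pi.
by apply: ring_eq; rewrite !ratioE; ring.
Qed.
Fact residueMDl : left_distributive residueM +%R.
Proof.
elim/quotW=> x; elim/quotW=> y; elim/quotW=> z.
rewrite -[LHS]/(residueM (residueD _ _) _) -[RHS]/(residueD _ _).
rewrite residueD_pi !residueM_pi residueD_pi.
by apply: ring_eq; rewrite !ratioE; ring.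
Qed.

HB.instance Definition _ := GRing.Zmodule_isComPzRing.Build K
  residueMA residueMC residue1M residueMDl.

Fact residue_zmod : zmod_morphism residue_fun.
Proof.
move=> a b; rewrite -[RHS]/(residueD _ (residueN _)) residueN_pi residueD_pi.
by apply: ring_eq; rewrite !ratioE; ring.
Qed.
Fact residue_monoid : monoid_morphism residue_fun.
Proof.
split=> // a b; rewrite -[RHS]/(residueM _ _) residueM_pi.
by apply: ring_eq; rewrite !ratioE; ring.
Qed.
HB.instance Definition _ :=
  GRing.isZmodMorphism.Build A K residue_fun residue_zmod.
HB.instance Definition _ :=
  GRing.isMonoidMorphism.Build A K residue_fun residue_monoid.

Definition residue_map : {rmorphism A -> K} := residue_fun.

Lemma residue_field_proper : 1 <> 0 :> K.
Proof.
by move/residue_eqP; rewrite !ratioE mul1r mul0r subr0; exact: prime_proper.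
Qed.

Lemma residue_fieldV (x : K) : x <> 0 -> exists y, x * y = 1.
Proof.
elim/quotW: x => x nz; have nx : ~ P (num x).
  move=> px; apply: nz; apply/residue_eqP.
  by rewrite !ratioE mulr1 mul0r subr0.
exists (\pi_K (mk_ratio (den x) nx)).
rewrite -[LHS]/(residueM _ _) residueM_pi.
by apply: ring_eq; rewrite !ratioE; ring.
Qed.

End ResidueField.

Section SpecMap.
Variables (S R : comPzRingType) (h : {rmorphism S -> R}) (q : Spec R).

Fact comap_ideal : is_ideal (h @^-1` prime_of q)%classic.
Proof.
have [q0 qD qM] := prime_ideal q; split=> [|x y|a x] /=.
- by rewrite rmorph0.
- by rewrite rmorphD; exact: qD.
- by rewrite rmorphM; exact: qM.
Qed.
Fact comap_proper : ~ (h @^-1` prime_of q)%classic 1.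
Proof. by rewrite /= rmorph1; exact: prime_proper. Qed.
Fact comapM a b : (h @^-1` prime_of q)%classic (a * b) ->
  (h @^-1` prime_of q)%classic a \/ (h @^-1` prime_of q)%classic b.
Proof. by rewrite /= rmorphM; exact: primeM. Qed.

Definition Spec_map : Spec S := SpecPoint comap_ideal comap_proper comapM.
End SpecMap.

Definition zariski_closed (A : comPzRingType) (Z : set (Spec A)) : Prop :=
  exists I : set A, Z = [set p : Spec A | (I `<=` prime_of p)%classic]%classic.

Definition closed_points (A : comPzRingType) : set (Spec A) :=
  [set p | zariski_closed [set p]%classic]%classic.

Section Relative.
Variables (S R : comPzRingType) (h : {rmorphism S -> R}).

Definition closed_image : set (Spec S) :=
  (Spec_map h @` @closed_points R)%classic.

Definition fiber_ring (s : Spec S) : comPzRingType :=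
  base_ring h (residue_map s).
Definition fiber_module (s : Spec S) (M : lmodType R) :
    lmodType (fiber_ring s) := base_module h (residue_map s) M.
Definition fiber_complex (s : Spec S) (E : cochain_complex R) :
    cochain_complex (fiber_ring s) := base_complex h (residue_map s) E.

(* Both notions are relative to a flat homomorphism, hence the clause
   flat_hom h. *)
Definition stably_reflexive_wrt (n : nat) (M : lmodType R) : Prop :=
  [/\ flat_hom h, flat_over h M
    & forall s, closed_image s -> stably_reflexive n (fiber_module s M)].

Definition stably_reflexive_complex_wrt (n : nat) (E : cochain_complex R) :
    Prop :=
  [/\ flat_hom h, fin_proj_complex E
    & forall s, closed_image s ->
        stably_reflexive_complex n (fiber_complex s E)].

End Relative.

(* Main.v *)
(** Call a complex of R-modules universally exact in degree i if it remains exact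
    there after tensoring over S with every S-module.  The key point is that, for
    finite projective R-modules, exactness in degree i of the fibres over the
    images of the closed points implies universal exactness in degree i.  By
    noetherian induction on the ideal a of S one proves exactness modulo a: for a
    composite this is a devissage using the flatness of R, and for a prime it
    follows from Nakayama's lemma at a maximal ideal of R, which applies because
    R is coherent.  Exactness modulo all ideals gives universal exactness.

    For (ii), E and its dual are therefore universally exact in degrees <= n, a
    property that passes to every base change, and M is flat since E is
    universally exact in degree -1.  Over one ring, a hull provides resolutions of
    M and of its dual, so that the cohomology of E and of its dual computes the
    Ext groups and the defect of reflexivity of M.

    For (i), E is a free resolution of M continued by the dual of a free
    resolution of the dual of M.  Flatness of M makes E universally exact in
    degrees < 0; Ext^1(M_s, R_s) = 0 makes the dual of E universally exact in
    degree 2, hence by dimension shifting in all degrees <= 2, and the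
    correspondence over R_s applies. *)

From HB Require Import structures.
From mathcomp Require Import all_boot all_order all_algebra generic_quotient.
From mathcomp Require Import boolp classical_sets.
From mathcomp Require Import ring zify.
Require Import Defs.

Set Implicit Arguments.
Unset Strict Implicit.
Unset Printing Implicit Defensive.

Import GRing.Theory.
Local Open Scope ring_scope.
Local Open Scope quotient_scope.

(** * Submodules, factorisation of linear maps, cokernels *)

Definition mklin (A : pzRingType) (U V : lmodType A) (f : U -> V)
    (lf : linear f) : {linear U -> V} :=
  HB.pack f (GRing.isLinear.Build A U V *:%R f lf).

(** Only the inclusion of the kernel in the image; the vanishing of the composite is stated
    separately. *)
Definition exact_at (T U V : nmodType) (f : T -> U) (g : U -> V) : Prop :=
  forall x, g x = 0 -> exists y, f y = x.

Section Submodule.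
Variables (A : comPzRingType) (V : lmodType A).

Record submod := Submod {
  sub_pred :> V -> Prop;
  sub_pred0 : sub_pred 0;
  sub_predD : forall x y, sub_pred x -> sub_pred y -> sub_pred (x + y);
  sub_predZ : forall a x, sub_pred x -> sub_pred (a *: x) }.

Variable K : submod.
Definition sub_mem : {pred V} := fun x => `[< K x >].

Fact sub_mem_closed : submod_closed sub_mem.
Proof.
split=> [|a x y /asboolP Kx /asboolP Ky]; apply/asboolP; first exact: sub_pred0.
by apply: sub_predD => //; apply: sub_predZ.
Qed.

Record submod_type := SubElt { sub_val : V; sub_valP : sub_val \in sub_mem }.
HB.instance Definition _ := [isSub for sub_val].
HB.instance Definition _ := [Choice of submod_type by <:].
HB.instance Definition _ := GRing.SubChoice_isSubLmodule.Build A V sub_mem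
  submod_type (GRing.submod_closed_semi sub_mem_closed).

Definition sub_inj : {linear submod_type -> V} := \val.

Lemma sub_inj_inj : injective sub_inj. Proof. exact: val_inj. Qed.
Lemma sub_injP x : K x <-> exists u, sub_inj u = x.
Proof.
split=> [Kx|[[y Ky] <-]]; last exact: (asboolW Ky).
have Kx' : x \in sub_mem by exact: asboolT.
by exists (SubElt Kx').
Qed.

End Submodule.
Arguments sub_inj {A V K}.
Arguments sub_inj_inj {A V} K.

Section Image.
Variables (A : comPzRingType) (U V : lmodType A) (f : {linear U -> V}).

Fact img0 : exists u, f u = 0. Proof. by exists 0; rewrite linear0. Qed.
Fact imgD x y : (exists u, f u = x) -> (exists u, f u = y) -> exists u, f u = x + y.
Proof. by move=> [u <-] [v <-]; exists (u + v); rewrite linearD. Qed.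
Fact imgZ a x : (exists u, f u = x) -> exists u, f u = a *: x.
Proof. by move=> [u <-]; exists (a *: u); rewrite linearZ. Qed.
Definition img : submod V := Submod img0 imgD imgZ.

End Image.

Section Factor.
Variables (A : comPzRingType) (U V W : lmodType A).

(** Preimages chosen pointwise depend linearly on [u] because [i] is injective. *)
Lemma factor_inj (i : {linear V -> W}) (f : {linear U -> W}) :
  injective i -> (forall u, exists v, i v = f u) ->
  exists g : {linear U -> V}, forall u, i (g u) = f u.
Proof.
move=> inj_i /choice[g gP].
have lg : linear g by move=> a x y; apply: inj_i; rewrite gP !linearP !gP.
by exists (mklin lg).
Qed.

(** The section [s] of [p] need not be linear, but [f] composed with it is, since [f] kills the
    kernel of [p]. *)
Lemma factor_surj (p : {linear U -> V}) (f : {linear U -> W}) :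
  surjective p -> (forall u, p u = 0 -> f u = 0) ->
  exists g : {linear V -> W}, forall u, g (p u) = f u.
Proof.
move=> /choice[s sK] kf.
have fE x y : p x = p y -> f x = f y.
  by move=> pxy; apply/eqP; rewrite -subr_eq0 -linearB kf // linearB pxy subrr.
have lg : linear (fun v => f (s v)).
  by move=> a x y; rewrite -linearP; apply: fE; rewrite linearP !sK.
by exists (mklin lg) => u; apply: fE; rewrite sK.
Qed.

Lemma coker_exact (f : {linear U -> V}) (p : {linear V -> W}) :
  (exists phi : {linear coker f -> W}, bijective phi /\
      forall v, phi (\pi v) = p v) ->
  surjective p /\ forall x, p x = 0 <-> exists y, f y = x.
Proof.
move=> [phi [bphi phiE]]; split=> [w|x].
  have [psi _ psiK] := bphi; exists (repr (psi w)).
  by rewrite -phiE reprK psiK.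
rewrite -phiE; split=> [px0|[y <-]].
  have : \pi_(coker f) x = \pi 0.
    by apply: (bij_inj bphi); rewrite px0; exact/esym/linear0.
  by move/eqP/coker_eqP => [u fu]; exists u; rewrite fu subr0.
have -> : \pi_(coker f) (f y) = 0.
  by apply/eqP/coker_eqP; exists y; rewrite subr0.
exact: linear0.
Qed.
End Factor.

Section CokerPi.
Variables (A : comPzRingType) (U V : lmodType A) (f : {linear U -> V}).
Definition coker_pi_fun (x : V) : coker f := \pi x.
Fact coker_pi_linear : linear coker_pi_fun.
Proof.
move=> a x y; rewrite -[RHS]/(cokerD (cokerZ _ _) _) /coker_pi_fun.
by rewrite cokerZ_pi cokerD_pi.
Qed.
Definition coker_pi : {linear V -> coker f} := mklin coker_pi_linear.

Lemma coker_pi_surj : surjective coker_pi.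
Proof. by move=> y; exists (repr y); rewrite /= /coker_pi_fun reprK. Qed.

Lemma coker_pi0 x : coker_pi x = 0 <-> exists y, f y = x.
Proof.
have -> : (coker_pi x = 0) = (\pi_(coker f) x = \pi 0) by [].
split=> [/eqP/coker_eqP[u fu]|[y <-]]; first by exists u; rewrite fu subr0.
by apply/eqP/coker_eqP; exists y; rewrite subr0.
Qed.

Lemma coker_iso (W : lmodType A) (p : {linear V -> W}) :
  surjective p -> (forall x, p x = 0 <-> exists y, f y = x) ->
  exists phi : {linear coker f -> W}, bijective phi.
Proof.
move=> sp kp.
have [|phi phiE] := factor_surj (f := p) coker_pi_surj.
  by move=> x /coker_pi0 /kp.
have [|psi psiE] := factor_surj (f := coker_pi) sp.
  by move=> x /kp /coker_pi0.
exists phi; exists psi => y.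
  by have [x <-] := coker_pi_surj y; rewrite phiE psiE.
by have [x <-] := sp y; rewrite psiE phiE.
Qed.
End CokerPi.
Arguments coker_pi_surj {A U V} f y.

(** Replaces the quotient type by a right exact sequence, the form that tensor products preserve. *)
Lemma hullP (A : comPzRingType) (E : cochain_complex A) (M : lmodType A) :
  hull E M <-> fin_proj_complex E /\
    exists p : {linear cobj E 0 -> M}, surjective p /\
      forall x, p x = 0 <-> exists y, cdiff E (-1) 0 y = x.
Proof.
split=> -[fpE].
  move=> [phi bphi]; split=> //.
  have lp : linear (fun x : cobj E 0 => phi (coker_pi (cdiff E (-1) 0) x)).
    by move=> a x y; rewrite !linearP.
  exists (mklin lp); apply: coker_exact.
  by exists phi; split.
by move=> [p [sp kp]]; split=> //; apply: coker_iso sp kp.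
Qed.

(** * Independence of Ext from the resolution *)

(** Meant for chain maps and homotopies, whose components live in types depending on the degree and
    are built from the preceding ones. *)
Lemma dependent_choice_nat (T : nat -> Type) (I : forall j, T j -> Prop)
    (r : forall j, T j -> T j.+1 -> Prop) :
  (exists x, I 0 x) ->
  (forall j x, I j x -> exists y, r j x y /\ I j.+1 y) ->
  exists f : forall j, T j, (forall j, I j (f j)) /\ forall j, r j (f j) (f j.+1).
Proof.
move=> /cid[x0 Ix0] step.
pose s (j : nat) : {x : T j | I j x} := nat_rect (fun j => {x : T j | I j x})
  (exist _ x0 Ix0)
  (fun j x => let y := cid (step j (sval x) (svalP x)) in
              exist _ (sval y) (proj2 (svalP y))) j.
exists (fun j => sval (s j)); split=> j; first exact: svalP.
by rewrite /=; case: cid => y [].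
Qed.

Section Resolutions.
Variable A : comPzRingType.

(** Projectivity lifts along surjections, so [d] and [f] are first corestricted to the image of
    [d]. *)
Lemma projective_lift (P X Y Z : lmodType A) (d : {linear X -> Y})
    (e : {linear Y -> Z}) (f : {linear P -> Y}) :
  projective P -> exact_at d e -> (forall x, e (f x) = 0) ->
  exists l : {linear P -> X}, forall x, d (l x) = f x.
Proof.
move=> projP de ef.
have [|q qE] := factor_inj (f := d) (sub_inj_inj (img d)).
  by move=> u; apply/sub_injP; exists u.
have [|k kE] := factor_inj (f := f) (sub_inj_inj (img d)).
  by move=> u; apply/sub_injP/de.
have [|l lE] := projP _ _ q k.
  move=> y; have /sub_injP[x dx] : exists u : submod_type (img d),
    sub_inj u = sub_inj y by exists y.
  by exists x; apply: sub_inj_inj; rewrite qE.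
by exists l => x; rewrite -qE lE kE.
Qed.

Section Augmented.
Variables (M : lmodType A) (P : proj_resolution M).

(* M is put in degree 0, hence P_i in degree i + 1. *)
Definition aug_obj (j : nat) : lmodType A :=
  if j is i.+1 then res_obj P i else M.
Definition aug_d (j : nat) : {linear aug_obj j.+1 -> aug_obj j} :=
  if j is i.+1 then res_d P i else res_aug P.

Lemma aug_exact j x : aug_d j x = 0 <-> exists y, aug_d j.+1 y = x.
Proof. by case: j x => [|j] x; [exact: res_exact0 | exact: res_exact]. Qed.

Lemma aug_dd j x : aug_d j (aug_d j.+1 x) = 0.
Proof. by apply/aug_exact; exists x. Qed.
End Augmented.

Section Comparison.
Variables (M : lmodType A).

(** The recursion carries two consecutive components, because the next lift uses the square they
    form; the [match] in the invariant makes the component on [M] the identity. *)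
Lemma chain_map_ex (P Q : proj_resolution M) :
  exists f : forall j, {linear aug_obj P j -> aug_obj Q j},
    (forall x, f 0 x = x) /\ forall j x, aug_d Q j (f j.+1 x) = f j (aug_d P j x).
Proof.
have [||s [Is rs]] := @dependent_choice_nat
  (fun j => {linear aug_obj P j -> aug_obj Q j} *
            {linear aug_obj P j.+1 -> aug_obj Q j.+1})%type
  (fun j s => (forall x, aug_d Q j (s.2 x) = s.1 (aug_d P j x)) /\
     (match j return {linear aug_obj P j -> aug_obj Q j} -> Prop with
      | 0 => fun f => f =1 id | _ => fun _ => True end) s.1)
  (fun j s s' => s'.1 = s.2).
- have [f0 f0E] := @res_proj _ _ P 0 _ _ (res_aug Q) (res_aug P) (@res_aug_surj _ _ Q).
  by exists (idfun : {linear M -> M}, f0).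
- move=> j [f g] /= [fg _].
  have lgd : linear (fun x => g (aug_d P j.+1 x)).
    by move=> a x y; rewrite !linearP.
  have [||g' g'E] := projective_lift (d := aug_d Q j.+1) (e := aug_d Q j)
    (f := mklin lgd) (@res_proj _ _ P j.+1).
  + by move=> x /aug_exact.
  + by move=> x /=; rewrite fg aug_dd linear0.
  by exists (g, g').
exists (fun j => (s j).1); split=> [x|j x]; first by have [_ ->] := Is 0%N.
by rewrite rs; have [] := Is j.
Qed.

(** Two consecutive components are carried again. The homotopy starts with zero on [M], where [u]
    vanishes; each later component lifts the remaining error, which is a cycle. *)
Lemma homotopy_ex (Q : proj_resolution M)
    (u : forall j, {linear aug_obj Q j -> aug_obj Q j}) :
  (forall x, u 0 x = 0) ->
  (forall j x, aug_d Q j (u j.+1 x) = u j (aug_d Q j x)) ->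
  exists k : forall j, {linear aug_obj Q j -> aug_obj Q j.+1},
    forall j x, u j.+1 x = aug_d Q j.+1 (k j.+1 x) + k j (aug_d Q j x).
Proof.
move=> u0 uC.
have [||s [Is rs]] := @dependent_choice_nat
  (fun j => {linear aug_obj Q j -> aug_obj Q j.+1} *
            {linear aug_obj Q j.+1 -> aug_obj Q j.+2})%type
  (fun j s => forall x, u j.+1 x = aug_d Q j.+1 (s.2 x) + s.1 (aug_d Q j x))
  (fun j s s' => s'.1 = s.2).
- have [||k kE] := projective_lift (d := aug_d Q 1) (e := aug_d Q 0)
    (f := u 1%N) (@res_proj _ _ Q 0).
  + by move=> x /aug_exact.
  + by move=> x; rewrite uC u0.
  by exists (\0%R : {linear _ -> _}, k) => x; rewrite /= kE addr0.
- move=> j [k k'] /= kE.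
  have ld : linear (fun x => u j.+2 x - k' (aug_d Q j.+1 x)).
    by move=> a x y; rewrite !linearP [in RHS]scalerDr addrACA.
  have [||k'' k''E] := projective_lift (d := aug_d Q j.+2) (e := aug_d Q j.+1)
    (f := mklin ld) (@res_proj _ _ Q j.+1).
  + by move=> x /aug_exact.
  + by move=> x /=; rewrite linearB uC kE aug_dd linear0 addr0 subrr.
  by exists (k', k''); split=> //= x; rewrite k''E /= subrK.
exists (fun j => (s j).1) => j x.
by rewrite rs Is.
Qed.

(** The comparison maps compose to a self-map of [Q] homotopic to the identity. Hence a cocycle
    [phi] differs by a coboundary from [phi] after [f] after [g], and [phi] after [f] is a
    coboundary on [P]. *)
Lemma hom_acyclic_indep (N : lmodType A) (P Q : proj_resolution M) i :
  (0 < i)%N -> hom_acyclic_at N P i -> hom_acyclic_at N Q i.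
Proof.
case: i => // i _ acP phi phid.
have [f [f0 fC]] := chain_map_ex P Q.
have [g [g0 gC]] := chain_map_ex Q P.
have lu j : linear (fun x => x - f j (g j x)).
  by move=> a x y; rewrite !linearP [in RHS]scalerDr addrACA.
have [||k kE] := @homotopy_ex Q (fun j => mklin (lu j)).
- by move=> x /=; rewrite f0 g0 subrr.
- by move=> j x /=; rewrite linearB fC gC.
have lpf : linear (fun x : res_obj P i.+1 => phi (f i.+2 x)).
  by move=> a x y; rewrite !linearP.
have [|psi psiE] := acP (mklin lpf).
  move=> x; rewrite /= -[res_d P _ x]/(aug_d P i.+2 x) -fC.
  exact: phid.
have lpsi : linear (fun x : res_obj Q i => psi (g i.+1 x) + phi (k i.+1 x)).
  by move=> a x y; rewrite !linearP scalerDr addrACA.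
exists (mklin lpsi) => x /=.
rewrite -[res_d Q i x]/(aug_d Q i.+1 x) -gC.
have /eqP := kE i.+1 x; rewrite /= subr_eq => /eqP xE.
have -> : phi x = phi (k i.+1 (res_d Q i x)) + phi (f i.+2 (g i.+2 x)).
  by rewrite {1}xE 2!linearD [phi (res_d _ _ _)]phid add0r.
by rewrite addrC; congr (_ + _); rewrite -[aug_d P _ _]/(res_d P i _) psiE.
Qed.

Lemma Ext_eq0P (N : lmodType A) (P : proj_resolution M) i : (0 < i)%N ->
  Ext_eq0 i M N <-> hom_acyclic_at N P i.
Proof. by move=> i0; split=> [|acP Q]; [exact | exact: hom_acyclic_indep acP]. Qed.
End Comparison.
End Resolutions.

(** * Finite projective modules and hulls over one ring *)

Section DualBasis.
Variable A : comPzRingType.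

Definition dual_basis (P : lmodType A) (k : nat) (e : 'I_k -> P)
    (phi : 'I_k -> dual P) : Prop :=
  forall x, x = \sum_i (hom_fun (phi i) x : A) *: e i.

Lemma row_map_linear (P : lmodType A) k (e : 'I_k -> P) :
  linear (fun v : 'rV[A]_k => \sum_i v 0 i *: e i).
Proof.
move=> a u v; rewrite scaler_sumr -big_split /=; apply: eq_bigr => i _.
by rewrite !mxE scalerDl scalerA.
Qed.
Definition row_map (P : lmodType A) k (e : 'I_k -> P) : {linear 'rV[A]_k -> P} :=
  mklin (row_map_linear e).

Lemma row_map_delta (P : lmodType A) k (e : 'I_k -> P) i :
  row_map e (delta_mx 0 i) = e i.
Proof.
rewrite /= (bigD1 i) //= big1 ?addr0 => [|j /negPf ji].
  by rewrite mxE !eqxx scale1r.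
by rewrite mxE ji andbF scale0r.
Qed.

Lemma linear_rowE (P : lmodType A) k (f : {linear 'rV[A]_k -> P}) v :
  f v = row_map (fun i => f (delta_mx 0 i)) v.
Proof.
rewrite {1}(row_sum_delta v) linear_sum /=.
by apply: eq_bigr => i _; rewrite linearZ.
Qed.

(** The dual basis criterion: finite projectivity becomes finite data that can be dualised and base
    changed. *)
Lemma fin_projP (P : lmodType A) :
  fin_proj P <-> exists k (e : 'I_k -> P) (phi : 'I_k -> dual P), dual_basis e phi.
Proof.
split=> [[[k [p sp]] projP]|[k [e [phi eP]]]].
  have [s sE] := projP _ _ p idfun sp.
  have lphi i : linear (fun x : P => s x 0 i : A^o).
    by move=> a x y; rewrite linearP !mxE.
  exists k, (fun i => p (delta_mx 0 i)), (fun i => mklin (lphi i)) => x.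
  by rewrite -{1}[x]sE linear_rowE.
split; first by exists k, (row_map e) => x; exists (\row_i hom_fun (phi i) x);
  rewrite {2}[x]eP /=; apply: eq_bigr => i _; rewrite mxE.
move=> X Y q f sq; have [g gE] := choice (fun i => sq (f (e i))).
have ll : linear (fun x : P => \sum_i (hom_fun (phi i) x : A) *: g i).
  move=> a x y; rewrite scaler_sumr -big_split /=; apply: eq_bigr => i _.
  by rewrite linearP scalerDl scalerA.
exists (mklin ll) => x; rewrite /= linear_sum [x in RHS]eP linear_sum /=.
by apply: eq_bigr => i _; rewrite !linearZ /= gE.
Qed.

Lemma hom_sumE (M N : lmodType A) k (F : 'I_k -> hom M N) x :
  hom_fun (\sum_i F i) x = \sum_i hom_fun (F i) x.
Proof.
have ladd : {morph (fun f : hom M N => hom_fun f x) : f g / f + g} by [].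
exact: (big_morph _ ladd).
Qed.

Lemma dual_basis_dual (P : lmodType A) k (e : 'I_k -> P) (phi : 'I_k -> dual P) :
  dual_basis e phi -> dual_basis phi (fun i => bidual P (e i)).
Proof.
move=> eP psi; apply: homP => x; rewrite hom_sumE [x in LHS]eP linear_sum.
by apply: eq_bigr => i _; rewrite linearZ; exact: mulrC.
Qed.

Lemma fin_proj_dual (P : lmodType A) : fin_proj P -> fin_proj (dual P).
Proof.
move/fin_projP=> [k [e [phi eP]]]; apply/fin_projP.
by exists k, phi, (fun i => bidual P (e i)); apply: dual_basis_dual.
Qed.

Lemma fin_proj_separated (P : lmodType A) : fin_proj P ->
  forall x : P, (forall phi : dual P, hom_fun phi x = 0) -> x = 0.
Proof.
move/fin_projP=> [k [e [phi eP]]] x x0.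
by rewrite [x]eP big1 // => i _; rewrite x0 scale0r.
Qed.

(** The coordinates of the preimage are the values of [Phi] on the functionals of a dual basis.
    Injectivity of evaluation is [fin_proj_separated]. *)
Lemma fin_proj_reflexive (P : lmodType A) : fin_proj P ->
  forall Phi : {linear dual P -> A^o},
  exists x, forall phi : dual P, Phi phi = hom_fun phi x.
Proof.
move/fin_projP=> [k [e [phi eP]]] Phi.
exists (\sum_i (Phi (phi i) : A) *: e i) => psi.
rewrite [psi in LHS](dual_basis_dual eP) linear_sum [RHS]linear_sum.
by apply: eq_bigr => i _; rewrite !linearZ; exact: mulrC.
Qed.

Lemma fin_proj_row k : fin_proj 'rV[A]_k.
Proof.
have lphi i : linear (fun x : 'rV[A]_k => x 0 i : A^o).
  by move=> a x y; rewrite !mxE.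
apply/fin_projP; exists k, (delta_mx 0), (fun i => mklin (lphi i)) => x.
exact: row_sum_delta.
Qed.
End DualBasis.

(** * Exactness of a complex and of its dual in a single degree *)

Section ComplexExactness.
Variables (A : comPzRingType) (E : cochain_complex A).

(** The neighbouring degrees are variables tied by equations, so that they can be instantiated in
    any convenient form without transport. *)
Definition exact_deg (j : int) : Prop := forall a b, a + 1 = j -> j + 1 = b ->
  exact_at (cdiff E a j) (cdiff E j b).
(** Indexed by the degree in [E]: this is exactness of the dual complex in degree [1 - j]. *)
Definition dual_exact_deg (j : int) : Prop := forall a b, a + 1 = j -> j + 1 = b ->
  exact_at (transpose (cdiff E j b)) (transpose (cdiff E a j)).

Lemma cohomology_eq0P i : cohomology_eq0 E i <-> exact_deg i.
Proof.
split=> [Ei a b aj <-|Ei x]; last by apply: Ei; rewrite ?subrK.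
by have -> : a = i - 1 by rewrite -aj addrK.
Qed.

Lemma dual_cohomology_eq0P i j : 1 - i = j ->
  cohomology_eq0 (dual_complex E) i <-> dual_exact_deg j.
Proof.
move=> <-; split=> [Ei a b aj bj|Ei x]; last by apply: Ei; lia.
have -> : a = 1 - (i + 1) by lia.
by have -> : b = 1 - (i - 1) by lia.
Qed.

Lemma stably_reflexive_complexP n : stably_reflexive_complex n E <->
  [/\ fin_proj_complex E, forall j, j <= n%:Z -> exact_deg j &
      forall j, 1 - n%:Z <= j -> dual_exact_deg j].
Proof.
split=> [[fpE exE]|[fpE exE dexE]].
  split=> // j jn; first by apply/cohomology_eq0P; have [] := exE _ jn.
  have /exE[_] : 1 - j <= n%:Z by lia.
  by apply: (iffLR (dual_cohomology_eq0P _)); lia.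
split=> // i iln; split; first exact/cohomology_eq0P/exE.
by apply/(dual_cohomology_eq0P (erefl (1 - i)))/dexE; lia.
Qed.
End ComplexExactness.

(** * Resolutions of a module and of its dual read off from a hull *)

Section Hull.
Variables (A : comPzRingType) (E : cochain_complex A) (M : lmodType A).
Hypothesis fpE : fin_proj_complex E.
Variable p : {linear cobj E 0 -> M}.
Hypothesis p_surj : surjective p.
Hypothesis p_ker : forall x, p x = 0 <-> exists y, cdiff E (-1) 0 y = x.

Lemma exact_iff (a b c : int) : exact_at (cdiff E a b) (cdiff E b c) ->
  forall x, cdiff E b c x = 0 <-> exists y, cdiff E a b y = x.
Proof. by move=> ex x; split=> [/ex|[y <-]]; last exact: cdiff_sq. Qed.

(** The degrees up to 0 of [E] resolve [M]. As [i] is positive, the [match] in [hom_acyclic_at] can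
    be restated with [i.-1], in the degrees of [E]. *)
Lemma hull_resolution : (forall j, j <= -1 -> exact_deg E j) ->
  { P : proj_resolution M | forall i (N : lmodType A), (0 < i)%N ->
      hom_acyclic_at N P i <->
      forall phi : {linear cobj E (- i%:Z) -> N},
        (forall x, phi (cdiff E (- i.+1%:Z) (- i%:Z) x) = 0) ->
        exists psi : {linear cobj E (- i.-1%:Z) -> N},
          forall x, psi (cdiff E (- i%:Z) (- i.-1%:Z) x) = phi x }.
Proof.
move=> exE.
have ex0 x : p x = 0 <-> exists y, cdiff E (- 1%:Z) (- 0%:Z) y = x by exact: p_ker.
have exi i : forall x, cdiff E (- i.+1%:Z) (- i%:Z) x = 0 <->
    exists y, cdiff E (- i.+2%:Z) (- i.+1%:Z) y = x.
  by apply: exact_iff; apply: exE; lia.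
exists (@ProjResolution A M (fun i => cobj E (- i%:Z))
  (fun i => cdiff E (- i.+1%:Z) (- i%:Z)) p
  (fun i => proj2 (fpE _)) p_surj ex0 exi).
by case.
Qed.

Lemma hull_map : exists d : {linear M -> cobj E 1},
  forall x, d (p x) = cdiff E 0 1 x.
Proof. by apply: factor_surj => // x /p_ker[y <-]; exact: cdiff_sq. Qed.

Variable d : {linear M -> cobj E 1}.
Hypothesis dE : forall x, d (p x) = cdiff E 0 1 x.

(** A functional on [M], pulled back to degree 0, kills the coboundaries, so exactness of the dual
    there makes it come from degree 1. *)
Lemma dual_hull_surj : dual_exact_deg E 0 -> surjective (transpose d).
Proof.
move=> ex0 phi; have [|||psi psiE] := ex0 (-1) 1 _ _ (transpose p phi) => //.
  apply: homP => y /=; suff -> : p (cdiff E (-1) 0 y) = 0 by rewrite linear0.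
  by apply/p_ker; exists y.
exists psi; apply: homP => m; have [x <-] := p_surj m.
by move/(congr1 (fun f => hom_fun f x)): psiE => /= <-; rewrite dE.
Qed.

(** The dual of degree 1 is the zeroth term of the resolution. This shift is why Ext^i of the dual
    of [M] corresponds to degree i + 1 of [E]. *)
Lemma dual_hull_resolution : (forall j, 0 <= j -> dual_exact_deg E j) ->
  { P : proj_resolution (dual M) | forall i (N : lmodType A), (0 < i)%N ->
      hom_acyclic_at N P i <->
      forall Phi : {linear dual (cobj E i.+1%:Z) -> N},
        (forall x, Phi (transpose (cdiff E i.+1%:Z i.+2%:Z) x) = 0) ->
        exists Psi : {linear dual (cobj E i%:Z) -> N},
          forall x, Psi (transpose (cdiff E i%:Z i.+1%:Z) x) = Phi x }.
Proof.
move=> exE.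
have exi i : forall x, transpose (cdiff E i%:Z i.+1%:Z) x = 0 <->
    exists y, transpose (cdiff E i.+1%:Z i.+2%:Z) y = x.
  move=> x; split=> [|[y <-]]; first by apply: exE; lia.
  by apply: homP => z /=; rewrite cdiff_sq linear0.
have ex0 (x : dual (cobj E 1%:Z)) : transpose d x = 0 <->
    exists y, transpose (cdiff E 1%:Z 2%:Z) y = x.
  rewrite -(exi 0%N); split=> xd; apply: homP => y /=.
    by rewrite -dE; move/(congr1 (fun f => hom_fun f (p y))): xd.
  by have [z <-] := p_surj y; rewrite dE; move/(congr1 (fun f => hom_fun f z)): xd.
exists (@ProjResolution A (dual M) (fun i => dual (cobj E i.+1%:Z))
  (fun i => transpose (cdiff E i.+1%:Z i.+2%:Z)) (transpose d)
  (fun i => proj2 (fin_proj_dual (fpE _))) (dual_hull_surj (exE 0 isT)) ex0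
  (fun i => exi i.+1)).
by case.
Qed.

End Hull.

(** * Stable reflexivity of a module and of its hull over one ring *)

Section Absolute.
Variables (A : comPzRingType) (E : cochain_complex A) (M : lmodType A).
Hypothesis hullE : hull E M.

(** Functionals on the dual of a finite projective module are evaluations at elements, so dualising
    the resolution of the dual of [M] gives back [E] in degrees at least 1. *)
Lemma exact_of_Ext_dual i : (forall j, 0 <= j -> dual_exact_deg E j) ->
  (0 < i)%N -> Ext_eq0 i (dual M) A^o <-> exact_deg E i.+1%:Z.
Proof.
move=> dexE i0; have [fpE [p [p_surj p_ker]]] := (iffLR (hullP _ _) hullE).
have [d dE] := hull_map p_surj p_ker.
have [P PE] := dual_hull_resolution fpE p_surj p_ker dE dexE.
rewrite (Ext_eq0P _ P i0) PE //; split=> [ac a b ai bi x xd|ex Phi Phid].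
  have ea : a = i%:Z by lia.
  have eb : b = i.+2%:Z by lia.
  clear ai bi; subst a b.
  have [|Psi PsiE] := ac (bidual _ x).
    by move=> phi; rewrite /= /ev_at /= xd linear0.
  have [y yE] := fin_proj_reflexive (fpE i%:Z) Psi.
  exists y; apply/eqP; rewrite -subr_eq0; apply/eqP.
  apply: (fin_proj_separated (fpE _)) => phi.
  by rewrite linearB; move: (PsiE phi); rewrite yE /= => ->; rewrite subrr.
have [x xE] := fin_proj_reflexive (fpE _) Phi.
have [|||y yE] := ex i%:Z i.+2%:Z _ _ x; try lia.
  apply: (fin_proj_separated (fpE _)) => phi.
  by have := Phid phi; rewrite xE.
by exists (bidual _ y) => phi; rewrite xE -yE.
Qed.

Lemma dual_exact_of_Ext i : (forall j, j <= -1 -> exact_deg E j) ->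
  (0 < i)%N -> Ext_eq0 i M A^o <-> dual_exact_deg E (- i%:Z).
Proof.
move=> exE i0; have [fpE [p [p_surj p_ker]]] := (iffLR (hullP _ _) hullE).
have [P PE] := hull_resolution fpE p_surj p_ker exE.
rewrite (Ext_eq0P _ P i0) PE //; split=> [ac a b ai bi phi phid|ex phi phid].
  have ea : a = - i.+1%:Z by lia.
  have eb : b = - i.-1%:Z by lia.
  clear ai bi; subst a b.
  have [|psi psiE] := ac (hom_fun phi).
    by move=> x; move/(congr1 (fun f => hom_fun f x)): phid.
  by exists psi; apply: homP.
have [|||psi psiE] := ex (- i.+1%:Z) (- i.-1%:Z) _ _ phi; try lia.
  by apply: homP => x; apply: phid.
by exists (hom_fun psi) => x; move/(congr1 (fun f => hom_fun f x)): psiE.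
Qed.

(** The dual of [M] is presented by the duals of degrees 2 and 1, so the bidual is the kernel of the
    differential from degree 1 to degree 2. Injectivity of evaluation is then exactness in degree 0,
    and surjectivity is exactness in degree 1. *)
Lemma reflexive_of_exact : (forall j, 0 <= j -> dual_exact_deg E j) ->
  reflexive_module M <-> exact_deg E 0 /\ exact_deg E 1.
Proof.
move=> dexE; have [fpE [p [p_surj p_ker]]] := (iffLR (hullP _ _) hullE).
have [d dE] := hull_map p_surj p_ker.
have sd := dual_hull_surj p_surj p_ker dE (dexE 0 isT).
split=> [[ev' evK ev'K]|[ex0 ex1]].
  have inj_ev := can_inj evK; split=> a b ai bi x xd.
    have ea : a = -1 by lia.
    have eb : b = 1 by lia.
    clear ai bi; subst a b; apply/p_ker/inj_ev; rewrite linear0; apply: homP => phi.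
    by have [psi <-] := sd phi; rewrite /= /ev_at /= dE xd linear0.
  have ea : a = 0 by lia.
  have eb : b = 2%:Z by lia.
  clear ai bi; subst a b.
  (* Evaluation at the cocycle [x] descends to a functional on the dual of [M]; the element of [M]
     representing it, lifted to degree 0, has coboundary [x]. *)
  have [|Phi PhiE] := factor_surj (p := transpose d) (f := bidual _ x) sd.
    move=> phi phid; rewrite /= /ev_at.
    have [||| psi <- /=] := dexE 1 isT 0 2%:Z _ _ phi => //.
      apply: homP => z /=; rewrite -dE.
      by move/(congr1 (fun f => hom_fun f (p z))): phid.
    by rewrite xd linear0.
  have [y yE] := p_surj (ev' Phi).
  exists y; apply/eqP; rewrite -subr_eq0; apply/eqP.
  apply: (fin_proj_separated (fpE _)) => phi.
  rewrite linearB -dE yE.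
  have /(congr1 (fun f => hom_fun f (transpose d phi))) /= := ev'K Phi.
  by rewrite /ev_at /= => ->; rewrite [X in X - _]PhiE /= subrr.
suff [inj_ev sev] : injective (bidual M) /\ surjective (bidual M).
  have [g gK] := choice sev; exists g => // x; apply: inj_ev; exact: gK.
split.
  suff ev0 (m : M) : bidual M m = 0 -> m = 0.
    move=> m m' mm'; apply/eqP; rewrite -subr_eq0; apply/eqP/ev0.
    by rewrite linearB mm' subrr.
  have [x <-] := p_surj m => evx; apply/p_ker; apply: ex0 => //.
  apply: (fin_proj_separated (fpE _)) => phi; rewrite -dE.
  by move/(congr1 (fun f => hom_fun f (transpose d phi))): evx.
move=> Phi.
have lPhi : linear (fun psi : dual (cobj E 1) => hom_fun Phi (transpose d psi)).
  by move=> a psi psi'; rewrite !linearP.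
have [x xE] := fin_proj_reflexive (fpE _) (mklin lPhi).
have [|||y yE] := ex1 0 2%:Z _ _ x; try lia.
  apply: (fin_proj_separated (fpE _)) => phi.
  rewrite -[LHS](xE (transpose (cdiff E 1 2%:Z) phi)) /=.
  suff -> : transpose_fun d (transpose_fun (cdiff E 1 2%:Z) phi) = 0 by rewrite linear0.
  apply: homP => m /=; have [z <-] := p_surj m.
  by rewrite dE cdiff_sq linear0.
exists (p y); apply: homP => phi; have [psi <-] := sd phi.
by rewrite /= /ev_at /= dE yE -xE.
Qed.

Variable n : nat.
Hypothesis n_gt0 : (0 < n)%N.

Lemma stably_reflexive_of_complex :
  stably_reflexive_complex n E -> stably_reflexive n M.
Proof.
move=> /stably_reflexive_complexP[_ exE dexE].
have dexE0 j : 0 <= j -> dual_exact_deg E j by move=> ?; apply: dexE; lia.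
have exE0 j : j <= -1 -> exact_deg E j by move=> ?; apply: exE; lia.
split; first by apply/(reflexive_of_exact dexE0); split; apply: exE; lia.
move=> i /andP[i0 iltn]; split.
  by apply/(dual_exact_of_Ext exE0 i0)/dexE; lia.
by apply/(exact_of_Ext_dual dexE0 i0)/exE; lia.
Qed.

Lemma complex_of_stably_reflexive :
  (forall j, j <= -1 -> exact_deg E j) ->
  (forall j, 0 <= j -> dual_exact_deg E j) ->
  stably_reflexive n M -> stably_reflexive_complex n E.
Proof.
move=> exE dexE [reflM ExtM]; have [fpE _] := hullE.
have [ex0 ex1] := (iffLR (reflexive_of_exact dexE) reflM).
apply/stably_reflexive_complexP; split=> // j jn.
  (* Degrees 0 and 1 are reflexivity, degree j + 2 is Ext^(j+1) of the dual of [M], and negative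
     degrees are assumed. *)
  case: j jn => [[|[|j]]|j] jn //; last by apply: exE; rewrite NegzE; lia.
  have jlt : (0 < j.+1 < n)%N by lia.
  by apply/(exact_of_Ext_dual dexE (ltn0Sn j)); have [] := ExtM _ jlt.
have [j0|j0] : 0 <= j \/ exists i, (0 < i < n)%N /\ j = - i%:Z.
- case: j jn => j jn; [by left; lia | right; exists j.+1; rewrite NegzE in jn *; lia].
- exact: dexE.
have [i [ilt ->]] := j0; have /andP[i0 _] := ilt.
by apply/(dual_exact_of_Ext exE i0); have [] := ExtM i ilt.
Qed.
End Absolute.

(** * Tensor products and flatness *)

Section TensorBasics.
Variables (S R R' : comPzRingType) (h : {rmorphism S -> R}).
Variable g : {rmorphism S -> R'}.

Lemma scale_pure (M : lmodType R) (N : lmodType R') (r : R) (r' : R') (m : M) (n : N) :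
  (pure h g (r : R^o) (r' : R'^o) : base_ring h g) *:
    (pure h g m n : tensor h g M N) = pure h g (r *: m) (r' *: n).
Proof. exact: actE. Qed.

Section Lift.
Variables (M : lmodType R) (N : lmodType R') (W : zmodType) (b : M -> N -> W).

Definition balanced : Prop :=
  [/\ forall m m' n, b (m + m') n = b m n + b m' n,
      forall m n n', b m (n + n') = b m n + b m n'
    & forall s m n, b (h s *: m) n = b m (g s *: n)].

Hypothesis bal : balanced.

Lemma lift_pure m n : tens_lift b (pure h g m n) = b m n.
Proof. by have [? ? ?] := bal; rewrite tens_lift_pure. Qed.

Lemma lift_additive : {morph (tens_lift b : tens h g M N -> W) : x y / x + y}.
Proof. by have [? ? ?] := bal; apply: tens_liftD. Qed.

Lemma lift0 : tens_lift b (0 : tens h g M N) = 0.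
Proof.
by apply: (addrI (tens_lift b (0 : tens h g M N))); rewrite -lift_additive !addr0.
Qed.
End Lift.

Lemma additive_ext (M : lmodType R) (N : lmodType R') (W : zmodType)
    (f k : tens h g M N -> W) :
  f 0 = 0 -> k 0 = 0 -> {morph f : x y / x + y} -> {morph k : x y / x + y} ->
  (forall m n, f (pure h g m n) = k (pure h g m n)) -> f =1 k.
Proof.
move=> f0 k0 fD kD fk; elim/tens_ind => [|a b Ha Hb|m n].
- by rewrite f0 k0.
- by rewrite fD kD Ha Hb.
- exact: fk.
Qed.

(** The composites are separate arguments with pointwise equations, so that no particular form of a
    composite is imposed. *)
Lemma tensor_map_comp (M M1 M2 : lmodType R) (N N1 N2 : lmodType R')
    (f : {linear M -> M1}) (f' : {linear M1 -> M2}) (f'' : {linear M -> M2})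
    (k : {linear N -> N1}) (k' : {linear N1 -> N2}) (k'' : {linear N -> N2}) :
  (forall m, f' (f m) = f'' m) -> (forall n, k' (k n) = k'' n) ->
  forall x, tensor_map h g f' k' (tensor_map h g f k x) = tensor_map h g f'' k'' x.
Proof.
move=> ff' kk'; apply: additive_ext => [||x y|x y|m n]; rewrite ?linear0 ?linearD //.
rewrite [X in tensor_map h g f' k' X]tensor_map_pure [LHS]tensor_map_pure ff' kk'.
by rewrite [RHS]tensor_map_pure.
Qed.

Lemma tensor_map_id (M : lmodType R) (N : lmodType R') (f : {linear M -> M})
    (k : {linear N -> N}) : f =1 id -> k =1 id -> tensor_map h g f k =1 id.
Proof.
move=> fE kE; apply: additive_ext => [||x y|x y|m n]; rewrite ?linear0 ?linearD //.
by rewrite [LHS]tensor_map_pure fE kE.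
Qed.

Lemma tensor_map_comp0 (M M1 M2 : lmodType R) (N N1 N2 : lmodType R')
    (f : {linear M -> M1}) (f' : {linear M1 -> M2})
    (k : {linear N -> N1}) (k' : {linear N1 -> N2}) :
  (forall m, f' (f m) = 0) ->
  forall x, tensor_map h g f' k' (tensor_map h g f k x) = 0.
Proof.
move=> ff'; apply: (@additive_ext _ _ _ _ (fun=> 0)) => [||x y|x y|m n];
  rewrite ?linear0 ?linearD ?addr0 //.
by rewrite [X in tensor_map h g f' k' X]tensor_map_pure [LHS]tensor_map_pure ff' pure0l.
Qed.

Lemma pure_suml (M : lmodType R) (N : lmodType R') k (m : 'I_k -> M) (n : N) :
  pure h g (\sum_i m i) n = \sum_i pure h g (m i) n.
Proof.
apply: (big_morph (fun m => pure h g m n)); first by move=> *; exact: pureDl.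
exact: pure0l.
Qed.

Lemma tensor_map_pure_sum (M M1 : lmodType R) (N N1 : lmodType R')
    (f : {linear M -> M1}) (k : {linear N -> N1}) j (m : 'I_j -> M) (n : 'I_j -> N) :
  tensor_map h g f k (\sum_i pure h g (m i) (n i)) =
  \sum_i pure h g (f (m i)) (k (n i)).
Proof.
rewrite (big_morph (tensor_map h g f k) (id1 := 0) (op1 := +%R)).
- by apply: eq_bigr => i _; exact: tensor_map_pure.
- exact: linearD.
- exact: linear0.
Qed.

Section RightExact.
Variables (A B M : lmodType R) (f : {linear A -> B}) (p : {linear B -> M}).
Variables (N : lmodType R').
Let fN := tensor_map h g f (idfun : {linear N -> N}).
Let pN := tensor_map h g p (idfun : {linear N -> N}).

Lemma tensor_surj : surjective p -> surjective pN.
Proof.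
move=> sp; elim/tens_ind => [|a b [x <-] [y <-]|m n].
- by exists 0; rewrite linear0.
- by exists (x + y); rewrite linearD.
- by have [b <-] := sp m; exists (pure h g b n); exact: tensor_map_pure.
Qed.

(** An inverse of [pN] modulo the image of [fN] sends m ⊗ n to the class of s(m) ⊗ n, where [s] is a
    section of [p]; it is balanced because [s] is linear modulo the image of [f]. *)
Lemma tensor_right_exact : surjective p ->
  (forall x, p x = 0 <-> exists y, f y = x) ->
  forall x, pN x = 0 <-> exists y, fN y = x.
Proof.
move=> /choice[s sK] kp x; split=> [px0|[y <-]]; last first.
  by apply: tensor_map_comp0 => m; apply/kp; exists m.
have kpE (b b' : B) n : p b = p b' ->
    coker_pi fN (pure h g b n) = coker_pi fN (pure h g b' n).
  move=> pbb; apply/eqP; rewrite -subr_eq0 -linearB; apply/eqP/coker_pi0.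
  have /kp[y yE] : p (b - b') = 0 by rewrite linearB pbb subrr.
  exists (pure h g y n); rewrite [LHS]tensor_map_pure yE.
  by apply/eqP; rewrite eq_sym subr_eq; apply/eqP; rewrite -[RHS]pureDl subrK.
have bal : balanced (fun m n => coker_pi fN (pure h g (s m) n)).
  split=> [m m' n|m n n'|a m n].
  - rewrite -linearD -[X in _ = coker_pi fN X]pureDl.
    by apply: kpE; rewrite linearD !sK.
  - by rewrite -linearD -[X in _ = coker_pi fN X]pureDr.
  - by rewrite -[X in _ = coker_pi fN X]pureZ; apply: kpE; rewrite linearZ !sK.
apply/coker_pi0; rewrite -(lift0 bal) -px0; move: x {px0}.
apply: additive_ext => [||x y|x y|b n]; rewrite ?linear0 ?linearD ?(lift0 bal) //.
- exact: lift_additive.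
- by rewrite [pN _]tensor_map_pure lift_pure //; apply: kpE; rewrite sK.
Qed.
End RightExact.
End TensorBasics.
Arguments tensor_map_comp {S R R'} h g {M M1 M2 N N1 N2} f f' f'' k k' k''.

Section Swap.
Variables (S R R' : comPzRingType) (h : {rmorphism S -> R}) (g : {rmorphism S -> R'}).

Lemma swap_balanced (M : lmodType R) (N : lmodType R') :
  balanced h g (fun (m : M) (n : N) => pure g h n m).
Proof.
split=> [m m' n|m n n'|s m n]; [exact: pureDr | exact: pureDl |].
by rewrite pureZ.
Qed.

Definition swap (M : lmodType R) (N : lmodType R') : tens h g M N -> tens g h N M :=
  tens_lift (fun (m : M) (n : N) => pure g h n m).
Lemma swap_pure (M : lmodType R) (N : lmodType R') (m : M) (n : N) :
  swap (pure h g m n) = pure g h n m.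
Proof. exact: (lift_pure (@swap_balanced M N)). Qed.
Lemma swapD (M : lmodType R) (N : lmodType R') : {morph @swap M N : x y / x + y}.
Proof. exact: (lift_additive (@swap_balanced M N)). Qed.
Lemma swap0 (M : lmodType R) (N : lmodType R') : @swap M N 0 = 0.
Proof. exact: (lift0 (@swap_balanced M N)). Qed.

Lemma swap_nat (M M1 : lmodType R) (N N1 : lmodType R') (f : {linear M -> M1})
    (k : {linear N -> N1}) x :
  swap (tensor_map h g f k x) = tensor_map g h k f (swap x).
Proof.
move: x; apply: additive_ext => [||x y|x y|m n].
- by rewrite linear0 swap0.
- by rewrite swap0 linear0.
- by rewrite linearD swapD.
- by rewrite swapD linearD.
- by rewrite [X in swap X]tensor_map_pure !swap_pure [RHS]tensor_map_pure.
Qed.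
End Swap.

Section RightExactRight.
Variables (S R R' : comPzRingType) (h : {rmorphism S -> R}) (g : {rmorphism S -> R'}).

Lemma swapK (M : lmodType R) (N : lmodType R') :
  cancel (@swap _ _ _ h g M N) (@swap _ _ _ g h N M).
Proof.
apply: additive_ext => [||x y|x y|m n] //; first by rewrite !swap0.
  by rewrite !swapD.
by rewrite !swap_pure.
Qed.

(** Exchanging the factors reduces this to exactness in the first factor. *)
Lemma tensor_right_exact_r (M : lmodType R) (A B N : lmodType R')
    (f : {linear A -> B}) (p : {linear B -> N}) :
  surjective p -> (forall x, p x = 0 <-> exists y, f y = x) ->
  surjective (tensor_map h g (idfun : {linear M -> M}) p) /\
  forall x, tensor_map h g (idfun : {linear M -> M}) p x = 0 <->
    exists y, tensor_map h g (idfun : {linear M -> M}) f y = x.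
Proof.
move=> sp kp; split=> [y|x].
  have [x xE] := tensor_surj (h := g) (g := h) (N := M) sp (swap y).
  by exists (swap x); rewrite -swap_nat xE swapK.
have kpM := tensor_right_exact (h := g) (g := h) (N := M) sp kp.
split=> [px|[y <-]].
  have [|y yE] := iffLR (kpM (swap x)); first by rewrite -swap_nat px swap0.
  by exists (swap y); rewrite -swap_nat yE swapK.
apply: (can_inj (@swapK _ _)); rewrite swap0 !swap_nat; apply/kpM.
by exists (swap y).
Qed.
End RightExactRight.

(** * Restriction of scalars *)

Section Restriction.
Variables (S R' : comPzRingType).

(** The morphism is a phantom argument that distinguishes the [S]-structures which different
    morphisms put on one carrier. *)
Definition restr of {rmorphism S -> R'} := fun N : lmodType R' => (N : Type).
Variables (g : {rmorphism S -> R'}) (N : lmodType R').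
Local Notation restrN := (restr g N).
HB.instance Definition _ := GRing.Zmodule.on restrN.
Definition restr_scale (s : S) (n : restrN) : restrN := g s *: (n : N).
Fact restr_scaleA a b v : restr_scale a (restr_scale b v) = restr_scale (a * b) v.
Proof. by rewrite /restr_scale scalerA rmorphM. Qed.
Fact restr_scale1 : left_id 1 restr_scale.
Proof. by move=> v; rewrite /restr_scale rmorph1 scale1r. Qed.
Fact restr_scaleDr : right_distributive restr_scale +%R.
Proof. by move=> a u v; rewrite /restr_scale scalerDr. Qed.
Fact restr_scaleDl v : {morph restr_scale^~ v : a b / a + b}.
Proof. by move=> a b; rewrite /restr_scale rmorphD scalerDl. Qed.
HB.instance Definition _ := GRing.Zmodule_isLmodule.Build S restrN
  restr_scaleA restr_scale1 restr_scaleDr restr_scaleDl.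
End Restriction.

Section RestrictionMap.
Variables (S R' : comPzRingType) (g : {rmorphism S -> R'}) (N N1 : lmodType R').
Variable k : {linear N -> N1}.
Fact restr_map_linear : linear (fun n : restr g N => k n : restr g N1).
Proof.
move=> a x y; rewrite -[a *: x + y]/(g a *: (x : N) + y) linearD linearZ.
by [].
Qed.
Definition restr_map : {linear restr g N -> restr g N1} := mklin restr_map_linear.
End RestrictionMap.

Notation idS S := (idfun : {rmorphism S -> S}) (only parsing).
Notation idM N := (idfun : {linear N -> N}) (only parsing).

Section Transfer.
Variables (S R R' : comPzRingType) (h : {rmorphism S -> R}).
Variable g : {rmorphism S -> R'}.

Section Restr.
Variables (M : lmodType R) (N : lmodType R').

Definition to_restr : tens h g M N -> tens h (idS S) M (restr g N) :=
  tens_lift (fun (m : M) (n : N) => pure h (idS S) m (n : restr g N)).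
Definition of_restr : tens h (idS S) M (restr g N) -> tens h g M N :=
  tens_lift (fun (m : M) (n : restr g N) => pure h g m (n : N)).

Let bal_to : balanced h g (fun (m : M) (n : N) => pure h (idS S) m (n : restr g N)).
Proof. by split=> *; rewrite ?pureDl ?pureDr // pureZ. Qed.
Let bal_of : balanced h (idS S) (fun (m : M) (n : restr g N) => pure h g m (n : N)).
Proof. by split=> *; rewrite ?pureDl ?pureDr // pureZ. Qed.

Lemma to_restr_pure m n : to_restr (pure h g m n) = pure h (idS S) m (n : restr g N).
Proof. exact: lift_pure. Qed.
Lemma of_restr_pure m n : of_restr (pure h (idS S) m (n : restr g N)) = pure h g m n.
Proof. exact: (lift_pure bal_of). Qed.
Lemma to_restrD : {morph to_restr : x y / x + y}. Proof. exact: lift_additive. Qed.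
Lemma of_restrD : {morph of_restr : x y / x + y}. Proof. exact: lift_additive. Qed.
Lemma to_restr0 : to_restr 0 = 0. Proof. exact: (lift0 bal_to). Qed.
Lemma of_restr0 : of_restr 0 = 0. Proof. exact: (lift0 bal_of). Qed.

Lemma to_restrK : cancel to_restr of_restr.
Proof.
apply: additive_ext => [||x y|x y|m n] //; rewrite ?to_restr0 ?of_restr0 //.
- by rewrite to_restrD of_restrD.
- by rewrite to_restr_pure of_restr_pure.
Qed.
End Restr.

Section RestrNat.
Variables (M M1 : lmodType R) (f : {linear M -> M1}) (N N1 : lmodType R').
Variable k : {linear N -> N1}.
Lemma to_restr_nat x :
  to_restr (tensor_map h g f k x) = tensor_map h (idS S) f (restr_map g k) (to_restr x).
Proof.
move: x; apply: additive_ext => [||x y|x y|m n].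
- by rewrite linear0 to_restr0.
- by rewrite to_restr0 linear0.
- by rewrite linearD to_restrD.
- by rewrite to_restrD linearD.
rewrite to_restr_pure [X in to_restr X]tensor_map_pure to_restr_pure.
by rewrite [RHS]tensor_map_pure.
Qed.
Lemma of_restr_nat x :
  of_restr (tensor_map h (idS S) f (restr_map g k) x) = tensor_map h g f k (of_restr x).
Proof.
move: x; apply: additive_ext => [||x y|x y|m n].
- by rewrite linear0 of_restr0.
- by rewrite of_restr0 linear0.
- by rewrite linearD of_restrD.
- by rewrite of_restrD linearD.
rewrite of_restr_pure [X in of_restr X]tensor_map_pure of_restr_pure.
by rewrite [RHS]tensor_map_pure.
Qed.
End RestrNat.
End Transfer.

(** * Universal exactness and the submodules aC *)

Section UniversalExactness.
Variables (S R : comPzRingType) (h : {rmorphism S -> R}).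

Definition uexact (A B C : lmodType R) (f : {linear A -> B}) (k : {linear B -> C}) :
    Prop :=
  forall N : lmodType S, exact_at (tensor_map h (idS S) f (idM N))
                                  (tensor_map h (idS S) k (idM N)).

Lemma restr_map_id (R' : comPzRingType) (g : {rmorphism S -> R'}) (M M1 : lmodType R)
    (f : {linear M -> M1}) (N : lmodType R') x :
  tensor_map h (idS S) f (restr_map g (idM N)) x =
  tensor_map h (idS S) f (idM (restr g N)) x.
Proof.
rewrite -[LHS](@tensor_map_id _ _ _ h (idS S) _ _ idfun idfun) //.
exact: (@tensor_map_comp _ _ _ h (idS S)).
Qed.

(** M ⊗_S N depends only on the [S]-module underlying [N]. *)
Lemma uexact_exact (A B C : lmodType R) (f : {linear A -> B}) (k : {linear B -> C}) :
  uexact f k -> forall (R' : comPzRingType) (g : {rmorphism S -> R'}) (N : lmodType R'),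
  exact_at (tensor_map h g f (idM N)) (tensor_map h g k (idM N)).
Proof.
move=> fk R' g N x kx; have [|y yE] := fk (restr g N) (to_restr x).
  by rewrite -restr_map_id -to_restr_nat kx to_restr0.
by exists (of_restr y); rewrite -of_restr_nat restr_map_id yE to_restrK.
Qed.

Section Imul.
Variables (C : lmodType R).

(* imul a c: c lies in aC. *)
Inductive imul (a : S -> Prop) : C -> Prop :=
| imul0 : imul a 0
| imulD x y of imul a x & imul a y : imul a (x + y)
| imulM s c of a s : imul a (h s *: c).

Lemma imulZ (a : S -> Prop) (r : R) c : imul a c -> imul a (r *: c).
Proof.
elim=> [|x y _ IHx _ IHy|s x sa]; first by rewrite scaler0; exact: imul0.
  by rewrite scalerDr; exact: imulD.
by rewrite scalerA mulrC -scalerA; exact: imulM.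
Qed.

Lemma imulN (a : S -> Prop) c : imul a c -> imul a (- c).
Proof. by rewrite -scaleN1r; exact: imulZ. Qed.

Lemma imulB (a : S -> Prop) x y : imul a x -> imul a y -> imul a (x - y).
Proof. by move=> ax /imulN; exact: imulD. Qed.

Lemma imulS (a b : S -> Prop) c : (forall s, a s -> b s) -> imul a c -> imul b c.
Proof.
move=> ab; elim=> [|x y _ IHx _ IHy|s x sa]; [exact: imul0|exact: imulD|].
exact/imulM/ab.
Qed.

Definition imul_submod (a : S -> Prop) : submod C :=
  Submod (imul0 a) (@imulD a) (@imulZ a).
End Imul.

Lemma imul_linear (B C : lmodType R) (f : {linear B -> C}) (a : S -> Prop) c :
  imul a c -> imul a (f c).
Proof.
elim=> [|x y _ IHx _ IHy|s x sa]; first by rewrite linear0; exact: imul0.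
  by rewrite linearD; exact: imulD.
by rewrite linearZ; exact: imulM.
Qed.

Section Annihilator.
Variables (N : lmodType S) (n : N).
Definition ann (s : S) : Prop := s *: n = 0.
Definition ann_submod : submod S^o.
Proof.
exists ann => [|x y|a x]; rewrite /ann ?scale0r // => nx.
  by move=> ny; rewrite scalerDl nx ny addr0.
by rewrite -scalerA nx scaler0.
Defined.
End Annihilator.

(** The submodule generated by [n] is S/ann(n), so by flatness c ⊗ 1 vanishes in C ⊗ S/ann(n), which
    is C/ann(n)C. *)
Lemma flat_pure_eq0 (C : lmodType R) (N : lmodType S) (c : C) (n : N) :
  flat_over h C -> pure h (idS S) c n = 0 -> imul (ann n) c.
Proof.
move=> flatC cn0.
pose i : {linear submod_type (ann_submod n) -> S^o} := sub_inj.
have iP s : (exists u, i u = s) <-> ann n s by rewrite -(sub_injP (ann_submod n)).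
pose q := coker_pi i.
have lk : linear (fun s : S^o => (s : S) *: n).
  by move=> a x y; rewrite scalerDl scalerA.
have [|k kE] := factor_surj (p := q) (f := mklin lk) (coker_pi_surj i).
  by move=> s /coker_pi0/iP.
have inj_k : injective k.
  move=> x y kxy; apply/eqP; rewrite -subr_eq0; apply/eqP.
  have : k (x - y) = 0 by rewrite linearB kxy subrr.
  by have [s <-] := coker_pi_surj i (x - y); rewrite kE => ns; apply/coker_pi0/iP.
have c10 : pure h (idS S) c (q 1) = 0.
  apply: (flatC _ _ k inj_k); rewrite linear0 [LHS]tensor_map_pure kE /= scale1r.
  exact: cn0.
pose D := coker_pi (@sub_inj _ _ (imul_submod C (ann n))).
have D0 x : D x = 0 <-> imul (ann n) x.
  by rewrite coker_pi0 -(sub_injP (imul_submod C (ann n))).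
have [r rK] := choice (coker_pi_surj i).
have DE s s' x : q s = q s' -> D (h s *: x) = D (h s' *: x).
  move=> ss'; apply/eqP; rewrite -subr_eq0 -linearB -scalerBl -rmorphB; apply/eqP/D0.
  by apply: imulM; apply/iP/coker_pi0; rewrite linearB ss' subrr.
(* The map to C/ann(n)C given by multiplication by representatives [r u]; it sends c ⊗ 1 to the
   class of [c]. *)
have bal : balanced h (idS S) (fun (x : C) (u : coker i) => D (h (r u) *: x)).
  split=> [m m' u|m u u'|s m u].
  - by rewrite scalerDr linearD.
  - rewrite -linearD -scalerDl -rmorphD; apply: DE.
    by rewrite linearD [LHS]rK ![q (r _)]rK.
  - rewrite scalerA -rmorphM; apply: DE; rewrite [RHS]rK mulrC.
    by rewrite -[s * _]/(s *: (_ : S^o)) linearZ [q (r _)]rK.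
apply/D0; rewrite -(lift0 bal) -c10 lift_pure //.
by rewrite -[in LHS](scale1r c) -(rmorph1 h); apply: DE; rewrite [RHS]rK.
Qed.
End UniversalExactness.

(** * Flatness and exactness modulo ideals *)

Section FlatExactness.
Variables (S R : comPzRingType) (h : {rmorphism S -> R}).

(** By a dual basis, an element of P ⊗ N is recovered from its images in R ⊗ N under the
    functionals, and flatness of [R] applies to each of these. *)
Lemma fin_proj_flat (P : lmodType R) : flat_hom h -> fin_proj P -> flat_over h P.
Proof.
move=> flatR /fin_projP[k [e [phi eP]]] N N1 f inj_f x y fxy.
have lin i : linear (fun r : R^o => (r : R) *: e i).
  by move=> a u v; rewrite scalerDl scalerA.
have xE z : z = \sum_i tensor_map h (idS S) (mklin (lin i)) (idM N)
                  (tensor_map h (idS S) (hom_fun (phi i)) (idM N) z).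
  move: z; apply: additive_ext => [||u v|u v|m n].
  - by [].
  - by rewrite big1 // => i _; rewrite !linear0.
  - by [].
  - by rewrite -big_split /=; apply: eq_bigr => i _; rewrite !linearD.
  rewrite [in LHS](eP m) pure_suml; apply: eq_bigr => i _.
  by rewrite [X in tensor_map _ _ _ _ X]tensor_map_pure [RHS]tensor_map_pure.
rewrite [x]xE [y]xE; apply: eq_bigr => i _; congr (tensor_map _ _ _ _ _).
apply: (flatR _ _ f inj_f).
rewrite !(tensor_map_comp h (idS S) (hom_fun (phi i)) idfun
  (hom_fun (phi i)) idfun f f) //.
move: fxy => /(congr1 (tensor_map h (idS S) (hom_fun (phi i)) (idM N1))).
by rewrite !(tensor_map_comp h (idS S) idfun (hom_fun (phi i))
  (hom_fun (phi i)) f idfun f).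
Qed.

(** The annihilator of the class of [s] in S/a is the colon ideal a : s, and c ⊗ s vanishes in C ⊗
    S/a. *)
Lemma flat_colon (C : lmodType R) (a : submod S^o) (s : S) (c : C) :
  flat_over h C -> imul h a (h s *: c) -> imul h (fun t => a (t * s)) c.
Proof.
move=> flatC ac; pose q := coker_pi (@sub_inj _ _ a).
have qP t : q t = 0 <-> a t by rewrite coker_pi0 -(sub_injP a).
have c0 : pure h (idS S) c (q s) = 0.
  rewrite -[s]mulr1 -[s * 1]/(s *: (1 : S^o)) linearZ -pureZ.
  elim: ac => [|x y _ IHx _ IHy|t x ta]; first exact: pure0l.
    by rewrite pureDl IHx IHy addr0.
  rewrite pureZ -linearZ -[_ *: _]/(t * 1) mulr1.
  by have /qP -> := ta; rewrite pure0r.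
apply: imulS (flat_pure_eq0 flatC c0) => t.
by rewrite /ann -linearZ => /qP.
Qed.

Section Sequence.
Variables (A B C : lmodType R) (f : {linear A -> B}) (k : {linear B -> C}).

(* Exactness of A/aA -> B/aB -> C/aC at B/aB. *)
Definition exact_mod (a : S -> Prop) : Prop :=
  forall e, imul h a (k e) -> exists y, imul h a (e - f y).

Definition all_exact_mod : Prop := forall a : submod S^o, exact_mod a.

Hypothesis kf : forall x, k (f x) = 0.
Hypothesis flatC : flat_over h C.

(* Modulo the submodule generated by the other n i, the last one spans a cyclic
   module S/a, so exactness modulo a removes the last term of the tensor. *)
Lemma uexact_of_exact_mod : all_exact_mod -> uexact h f k.
Proof.
move=> exfk N x.
suff sumP j (b : 'I_j -> B) (n : 'I_j -> N) :
    tensor_map h (idS S) k (idM N) (\sum_i pure h (idS S) (b i) (n i)) = 0 ->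
    exists y, tensor_map h (idS S) f (idM N) y = \sum_i pure h (idS S) (b i) (n i).
  have [l ->] : exists l : seq (B * N), x = \sum_(y <- l) pure h (idS S) y.1 y.2.
    by exists (repr x); rewrite -pi_sum reprK.
  by rewrite (big_nth (0, 0)) big_mkord; exact: sumP.
elim: j b n => [|j IHj] b n; first by rewrite big_ord0; exists 0; rewrite linear0.
rewrite big_ord_recr /=; set w := widen_ord _; set l := ord_max.
pose g := row_map (fun i => n (w i)).
move=> k0.
have kl0 : pure h (idS S) (k (b l)) (coker_pi g (n l)) = 0.
  move/(congr1 (tensor_map h (idS S) (idM C) (coker_pi g))): k0.
  rewrite linear0 !linearD tensor_map_pure_sum tensor_map_pure_sum.
  rewrite [X in _ + tensor_map _ _ _ _ X]tensor_map_pure.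
  rewrite [X in _ + X]tensor_map_pure => <-; rewrite big1 ?add0r // => i _.
  suff -> : coker_pi g (n (w i)) = 0 by exact: pure0r.
  by apply/coker_pi0; exists (delta_mx 0 i); rewrite row_map_delta.
have [y yP] := exfk (ann_submod (coker_pi g (n l))) _ (flat_pure_eq0 flatC kl0).
(* The difference lies in aB, and [a] carries [n l] into the span of the other [n i]; so its tensor
   with [n l] can be rewritten in terms of those. *)
have [b' b'E] : exists b' : 'I_j -> B,
    pure h (idS S) (b l - f y) (n l) = \sum_i pure h (idS S) (b' i) (n (w i)).
  elim: yP => [|u v _ [u' u'E] _ [v' v'E]|s u us].
  - by exists (fun=> 0); rewrite pure0l big1 // => i _; rewrite pure0l.
  - exists (fun i => u' i + v' i); rewrite pureDl u'E v'E -big_split /=.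
    by apply: eq_bigr => i _; rewrite pureDl.
  have [v vE] : exists v, g v = s *: n l.
    by apply/coker_pi0; rewrite linearZ.
  exists (fun i => h (v 0 i) *: u); rewrite pureZ -vE.
  rewrite (big_morph (pure h (idS S) u) (id1 := 0) (op1 := +%R)).
  - by apply: eq_bigr => i _; rewrite pureZ.
  - by move=> ? ?; exact: pureDr.
  - exact: pure0r.
have blE : pure h (idS S) (b l) (n l) =
    tensor_map h (idS S) f (idM N) (pure h (idS S) y (n l)) +
    \sum_i pure h (idS S) (b' i) (n (w i)).
  by rewrite -b'E [X in _ = X + _]tensor_map_pure /= -pureDl addrC subrK.
have [|z zE] := IHj (fun i => b (w i) + b' i) (n \o w).
  rewrite -[RHS]k0 blE [in RHS]addrCA [RHS]linearD.
  rewrite [X in _ = X + _]tensor_map_comp0 // add0r -big_split /=.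
  by congr tensor_map_fun; apply: eq_bigr => i _; rewrite pureDl.
exists (z + pure h (idS S) y (n l)); rewrite linearD zE blE [RHS]addrCA addrC.
congr (_ + _); rewrite -big_split /=.
by apply: eq_bigr => i _; rewrite pureDl.
Qed.

(* Dimension shifting along 0 -> a -> S -> S/a -> 0. *)
Lemma uexact_pred (D : lmodType R) (d : {linear C -> D}) :
  flat_over h D -> (forall x, d (k x) = 0) ->
  exact_at f k -> uexact h k d -> uexact h f k.
Proof.
move=> flatD dk ex_fk ex_kd; apply: uexact_of_exact_mod => a e ake.
pose i : {linear submod_type a -> S^o} := sub_inj.
have [z zE] : exists z, tensor_map h (idS S) (idM C) i z =
    pure h (idS S) (k e) (1 : S^o).
  elim: ake => [|u v _ [u' u'E] _ [v' v'E]|s u us].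
  - by exists 0; rewrite linear0 pure0l.
  - by exists (u' + v'); rewrite linearD u'E v'E pureDl.
  have [s' s'E] := (iffLR (sub_injP a s) us).
  exists (pure h (idS S) u s'); rewrite [LHS]tensor_map_pure /= pureZ.
  by rewrite -[_ *: _]/(s * 1) mulr1 -s'E.
have bal : balanced h (idS S) (fun (x : B) (s : submod_type a) => h (i s) *: x).
  split=> [m m' s|m s s'|t m s]; first by rewrite scalerDr.
    by rewrite linearD rmorphD scalerDl.
  by rewrite scalerA linearZ rmorphM mulrC.
have balC : balanced h (idS S) (fun (x : C) (s : S^o) => h s *: x).
  split=> [m m' s|m s s'|t m s]; first by rewrite scalerDr.
    by rewrite rmorphD scalerDl.
  by rewrite scalerA rmorphM mulrC.
(* Flatness of [D] embeds D ⊗ a in D ⊗ S, where [z] becomes d(k e) ⊗ 1 = 0; hence [z] comes from B ⊗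
   a. *)
have [|y yE] := ex_kd _ z.
  apply: (flatD _ _ i (sub_inj_inj a)); rewrite linear0.
  rewrite (tensor_map_comp h (idS S) _ _ d _ _ i) //.
  rewrite -[LHS](tensor_map_comp h (idS S) idfun d _ i idfun) //.
  by rewrite zE [LHS]tensor_map_pure dk pure0l.
(* Multiplication from B ⊗ a to aB. As [mu y] and [e] have the same image under [k], exactness over
   [R] makes their difference an image under [f]. *)
pose mu (x : tens h (idS S) B (submod_type a)) :=
  tens_lift (fun (x : B) (s : submod_type a) => h (i s) *: x) x.
have mua x : imul h a (mu x).
  elim/tens_ind: x => [|x x' Hx Hx'|m s]; rewrite /mu.
  - by rewrite (lift0 bal); exact: imul0.
  - by rewrite (lift_additive bal); exact: imulD.
  - by rewrite (lift_pure bal); apply: imulM; apply/sub_injP; exists s.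
have kmu : k (mu y) = k e.
  transitivity (tens_lift (fun (x : C) (s : S^o) => h s *: x)
      (tensor_map h (idS S) k i y)).
    move: {yE} y; apply: additive_ext => [||x x'|x x'|m s].
    - by rewrite /mu (lift0 bal) linear0.
    - by rewrite linear0 (lift0 balC).
    - by rewrite /mu (lift_additive bal) linearD.
    - by rewrite linearD (lift_additive balC).
    rewrite /mu (lift_pure bal) [X in tens_lift _ X]tensor_map_pure (lift_pure balC).
    by rewrite linearZ.
  rewrite -[X in tens_lift _ X](tensor_map_comp h (idS S) k idfun _ idfun i) //.
  by rewrite yE zE (lift_pure balC) rmorph1 scale1r.
have [|x xE] := ex_fk (e - mu y); first by rewrite linearB kmu subrr.
by exists x; rewrite xE opprB addrC subrK.
Qed.
End Sequence.
End FlatExactness.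

(** * Base change and duality *)

Section BaseChange.
Variables (S R S' : comPzRingType) (h : {rmorphism S -> R}) (g : {rmorphism S -> S'}).
Local Notation h' := (base_hom h g).
Local Notation "M '_B'" := (base_module h g M) (at level 2, format "M '_B'").
Local Notation base_map f := (tensor_map h g f (idM S'^o)).

Lemma base_hom_scale_pure (M : lmodType R) (N : lmodType S') s (m : M) (n : N) :
  h' s *: (pure h g m n : tensor h g M N) = pure h g m (s *: n).
Proof. by rewrite [LHS]scale_pure scale1r. Qed.

Section Assoc.
Variables (M : lmodType R) (N : lmodType S').

(** The map out of the triple tensor product is built in two stages: first for fixed [n], then
    balanced in [n]. *)
Definition assoc_at (n : N) : tens h g M S'^o -> tens h (idS S) M (restr g N) :=
  tens_lift (fun (m : M) (s : S'^o) => pure h (idS S) m ((s : S') *: n : restr g N)).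

Lemma assoc_at_balanced n : balanced h g
  (fun (m : M) (s : S'^o) => pure h (idS S) m ((s : S') *: n : restr g N)).
Proof.
split=> [m m' s|m s s'|t m s]; first exact: pureDl.
  by rewrite scalerDl pureDr.
rewrite pureZ; congr pure.
by rewrite -[LHS]/(g t *: (s *: n)) scalerA.
Qed.

Lemma assoc_at_pure n m s :
  assoc_at n (pure h g m s) = pure h (idS S) m ((s : S') *: n : restr g N).
Proof. exact: (lift_pure (assoc_at_balanced n)). Qed.
Lemma assoc_atD n : {morph assoc_at n : x y / x + y}.
Proof. exact: (lift_additive (assoc_at_balanced n)). Qed.
Lemma assoc_at0 n : assoc_at n 0 = 0.
Proof. exact: (lift0 (assoc_at_balanced n)). Qed.

Lemma assoc_balanced : balanced h' (idS S') (fun (x : M _B) (n : N) => assoc_at n x).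
Proof.
split=> [x x' n|x n n'|s x n]; first exact: assoc_atD.
  move: x; apply: additive_ext => [||x y|x y|m t].
  - exact: assoc_at0.
  - by rewrite !assoc_at0 addr0.
  - exact: assoc_atD.
  - by rewrite !assoc_atD addrACA.
  - by rewrite !assoc_at_pure scalerDr pureDr.
move: x; apply: additive_ext => [||x y|x y|m t].
- by rewrite scaler0 assoc_at0.
- exact: assoc_at0.
- by rewrite scalerDr assoc_atD.
- exact: assoc_atD.
- by rewrite [X in assoc_at _ X]base_hom_scale_pure !assoc_at_pure scalerA mulrC.
Qed.

(* (M ⊗_S S') ⊗_S' N = M ⊗_S N *)
Definition assoc : tens h' (idS S') M _B N -> tens h (idS S) M (restr g N) :=
  tens_lift (fun (x : M _B) (n : N) => assoc_at n x).
Lemma assoc_pure x n : assoc (pure h' (idS S') x n) = assoc_at n x.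
Proof. exact: (lift_pure assoc_balanced). Qed.
Lemma assocD : {morph assoc : x y / x + y}.
Proof. exact: (lift_additive assoc_balanced). Qed.
Lemma assoc0 : assoc 0 = 0.
Proof. exact: (lift0 assoc_balanced). Qed.

Lemma assoc_inv_balanced : balanced h (idS S) (fun (m : M) (n : restr g N) =>
  pure h' (idS S') (pure h g m (1 : S'^o) : M _B) (n : N)).
Proof.
split=> [m m' n|m n n'|s m n]; first by rewrite -pureDl; congr pure; exact: pureDl.
  by rewrite pureDr.
rewrite -[RHS](pureZ h' (idS S') (g s)); congr pure.
by rewrite [RHS]base_hom_scale_pure; exact: pureZ.
Qed.
Definition assoc_inv : tens h (idS S) M (restr g N) -> tens h' (idS S') M _B N :=
  tens_lift (fun (m : M) (n : restr g N) =>
    pure h' (idS S') (pure h g m (1 : S'^o) : M _B) (n : N)).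
Lemma assoc_inv_pure m n : assoc_inv (pure h (idS S) m n) =
  pure h' (idS S') (pure h g m (1 : S'^o) : M _B) (n : N).
Proof. exact: (lift_pure assoc_inv_balanced). Qed.
Lemma assoc_invD : {morph assoc_inv : x y / x + y}.
Proof. exact: (lift_additive assoc_inv_balanced). Qed.
Lemma assoc_inv0 : assoc_inv 0 = 0.
Proof. exact: (lift0 assoc_inv_balanced). Qed.

Lemma assocK : cancel assoc assoc_inv.
Proof.
apply: additive_ext => [||x y|x y|x n] //; first by rewrite assoc0 assoc_inv0.
  by rewrite assocD assoc_invD.
rewrite assoc_pure; move: x; apply: additive_ext => [||x y|x y|m s].
- by rewrite assoc_at0 assoc_inv0.
- exact: pure0l.
- by rewrite assoc_atD assoc_invD.
- exact: pureDl.
rewrite assoc_at_pure assoc_inv_pure -pureZ [X in pure _ _ X](base_hom_scale_pure).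
by rewrite -[s *: _]/(s * 1) mulr1.
Qed.

Lemma assoc_invK : cancel assoc_inv assoc.
Proof.
apply: additive_ext => [||x y|x y|m n] //; first by rewrite assoc_inv0 assoc0.
  by rewrite assoc_invD assocD.
by rewrite assoc_inv_pure assoc_pure assoc_at_pure scale1r.
Qed.
End Assoc.

Lemma assoc_nat (M M1 : lmodType R) (f : {linear M -> M1}) (N N1 : lmodType S')
    (k : {linear N -> N1}) x :
  assoc (tensor_map h' (idS S') (base_map f) k x) =
  tensor_map h (idS S) f (restr_map g k) (assoc x).
Proof.
move: x; apply: additive_ext => [||x y|x y|x n].
- by rewrite linear0 assoc0.
- by rewrite assoc0 linear0.
- by rewrite linearD assocD.
- by rewrite assocD linearD.
rewrite assoc_pure [X in assoc X]tensor_map_pure assoc_pure.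
move: x; apply: additive_ext => [||x y|x y|m s].
- by rewrite [X in assoc_at _ X]linear0 assoc_at0.
- by rewrite assoc_at0 linear0.
- by rewrite [X in assoc_at _ X]linearD assoc_atD.
- by rewrite assoc_atD linearD.
rewrite [X in assoc_at _ X]tensor_map_pure !assoc_at_pure [RHS]tensor_map_pure /=.
by rewrite linearZ.
Qed.

(** By associativity, tensoring the base change over [S'] with a module is tensoring [M] over [S]
    with its restriction, and restriction keeps [k] injective. *)
Lemma flat_base (M : lmodType R) : flat_over h M -> flat_over h' M _B.
Proof.
move=> flatM N N1 k inj_k x y.
have baseE (N2 N3 : lmodType S') (k' : {linear N2 -> N3}) z :
    tensor_map h' (idS S') (base_map (idM M)) k' z =
    tensor_map h' (idS S') (idM M _B) k' z.
  move: z; apply: additive_ext => [||u v|u v|u n]; rewrite ?linear0 ?linearD //.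
  rewrite [LHS]tensor_map_pure [RHS]tensor_map_pure; congr pure.
  exact: tensor_map_id.
rewrite -!baseE => /(congr1 (@assoc _ _)); rewrite !assoc_nat => e.
by apply: (can_inj (@assocK _ _)); apply: (flatM _ _ (restr_map g k)).
Qed.

Lemma uexact_base (A B C : lmodType R) (f : {linear A -> B}) (k : {linear B -> C}) :
  uexact h f k -> uexact h' (base_map f) (base_map k).
Proof.
move=> fk N x kx; have [|y yE] := fk (restr g N) (assoc x).
  by rewrite -restr_map_id -assoc_nat kx assoc0.
exists (assoc_inv y); apply: (can_inj (@assocK _ _)).
by rewrite assoc_nat assoc_invK restr_map_id.
Qed.

Section BaseDual.
Variable P : lmodType R.

Fact base_functional_linear (phi : dual P) :
  linear (fun x : P _B => base_map (hom_fun phi) x : (base_ring h g)^o).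
Proof. by move=> a x y; exact: linearP. Qed.
Definition base_functional (phi : dual P) : dual P _B :=
  mklin (base_functional_linear phi).

Lemma base_functional_pure phi p s :
  hom_fun (base_functional phi) (pure h g p s) = pure h g (hom_fun phi p) s.
Proof. exact: tensor_map_pure. Qed.

Lemma base_dual_ext (u v : dual P _B) :
  (forall p s, hom_fun u (pure h g p s) = hom_fun v (pure h g p s)) -> u = v.
Proof.
move=> uv; apply: homP; apply: additive_ext => //.
- exact: linear0.
- exact: linear0.
- by move=> x y; exact: linearD.
- by move=> x y; exact: linearD.
Qed.

Lemma base_functionalD phi psi :
  base_functional (phi + psi) = base_functional phi + base_functional psi.
Proof.
apply: base_dual_ext => p s; rewrite -[RHS]/(hom_fun _ _ + hom_fun _ _).
by rewrite !base_functional_pure -pureDl.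
Qed.

Lemma base_functionalZ r s phi :
  (pure h g (r : R^o) (s : S'^o) : base_ring h g) *: base_functional phi =
  h' s *: base_functional (r *: phi).
Proof.
apply: base_dual_ext => p t.
rewrite -[LHS]/(_ *: hom_fun _ _) -[RHS]/(_ *: hom_fun _ _) !base_functional_pure.
by rewrite [LHS]scale_pure [RHS]scale_pure scale1r.
Qed.

Lemma base_dual_balanced : balanced h g
  (fun (phi : dual P) (s : S'^o) => h' (s : S') *: base_functional phi).
Proof.
split=> [phi psi s|phi s t|s phi t]; first by rewrite base_functionalD scalerDr.
  by rewrite rmorphD scalerDl.
rewrite -base_functionalZ; congr (_ *: _).
rewrite -[RHS]/(pure h g (1 : R^o) (g s *: t)) -[RHS]pureZ.
by congr pure; rewrite -[_ *: _]/(h s * 1) mulr1.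
Qed.

(** The canonical map from the base change of the dual to the dual of the base change. *)
Definition base_dual : tens h g (dual P) S'^o -> dual P _B :=
  tens_lift (fun (phi : dual P) (s : S'^o) => h' (s : S') *: base_functional phi).
Lemma base_dual_pure phi s :
  base_dual (pure h g phi s) = h' (s : S') *: base_functional phi.
Proof. exact: (lift_pure base_dual_balanced). Qed.
Lemma base_dualD : {morph base_dual : x y / x + y}.
Proof. exact: (lift_additive base_dual_balanced). Qed.
Lemma base_dual0 : base_dual 0 = 0.
Proof. exact: (lift0 base_dual_balanced). Qed.

Lemma base_dualZ (c : base_ring h g) phi :
  base_dual (c *: (pure h g phi (1 : S'^o) : (dual P) _B)) = c *: base_functional phi.
Proof.
move: c; apply: (@additive_ext S R S' h g R^o S'^o) => [||x y|x y|r s].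
- by rewrite scale0r base_dual0.
- by rewrite scale0r.
- by rewrite [X in base_dual X]scalerDl base_dualD.
- by rewrite scalerDl.
rewrite [X in base_dual X]scale_pure base_dual_pure [RHS]base_functionalZ.
by congr (h' _ *: _); exact: mulr1.
Qed.

Section Basis.
Variables (j : nat) (e : 'I_j -> P) (phi : 'I_j -> dual P).
Hypothesis eP : dual_basis e phi.

Lemma base_dual_basis :
  dual_basis (fun i => pure h g (e i) (1 : S'^o) : P _B)
    (fun i => base_functional (phi i)).
Proof.
apply: additive_ext => [||x y|x y|p s] //.
- by rewrite big1 // => i _; rewrite linear0 scale0r.
- by rewrite -big_split /=; apply: eq_bigr => i _; rewrite linearD scalerDl.
rewrite [in LHS](eP p) pure_suml; apply: eq_bigr => i _.
rewrite base_functional_pure [RHS]scale_pure.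
by congr pure; exact/esym/mulr1.
Qed.

(** Each [z] is recovered from the values of [base_dual z] on the e_i ⊗ 1, whence injectivity;
    expanding [psi] in the dual basis of the base change gives a preimage. *)
Lemma base_dual_bij : injective base_dual /\ surjective base_dual.
Proof.
have zE (z : (dual P) _B) : z = \sum_i
    (hom_fun (base_dual z) (pure h g (e i) (1 : S'^o)) : base_ring h g) *:
    (pure h g (phi i) (1 : S'^o) : (dual P) _B).
  move: z; apply: additive_ext => [||x y|x y|psi s] //.
  - by rewrite base_dual0 big1 // => i _; rewrite scale0r.
  - rewrite base_dualD -big_split; apply: eq_bigr => i _ /=.
    by rewrite -[X in X *: _]/(hom_fun _ _ + hom_fun _ _) scalerDl.
  rewrite [in LHS](dual_basis_dual eP psi) pure_suml; apply: eq_bigr => i _.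
  rewrite base_dual_pure -[X in _ = X *: _]/(h' s *: hom_fun _ _) base_functional_pure.
  rewrite [X in _ = X *: _]scale_pure [RHS]scale_pure scale1r.
  by congr pure; rewrite -[RHS]/(s * 1 * 1) !mulr1.
split=> [x y xy|psi]; first by rewrite [x]zE [y]zE xy.
exists (\sum_i (hom_fun psi (pure h g (e i) (1 : S'^o)) : base_ring h g) *:
  (pure h g (phi i) (1 : S'^o) : (dual P) _B)).
rewrite [RHS](dual_basis_dual base_dual_basis).
rewrite (big_morph base_dual base_dualD base_dual0).
by apply: eq_bigr => i _; rewrite base_dualZ.
Qed.
End Basis.
End BaseDual.

Lemma fin_proj_base (P : lmodType R) : fin_proj P -> fin_proj P _B.
Proof.
move=> /fin_projP[j [e [phi eP]]]; apply/fin_projP; exists j.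
by do 2 eexists; exact: base_dual_basis eP.
Qed.

Lemma base_dual_nat (P Q : lmodType R) (f : {linear P -> Q}) z :
  base_dual (base_map (transpose f) z) = transpose (base_map f) (base_dual z).
Proof.
move: z; apply: additive_ext => [||x y|x y|phi s].
- by rewrite [X in base_dual X]linear0 base_dual0.
- by rewrite base_dual0 linear0.
- by rewrite [X in base_dual X]linearD base_dualD.
- by rewrite base_dualD linearD.
rewrite [X in base_dual X]tensor_map_pure !base_dual_pure linearZ; congr (_ *: _).
apply: base_dual_ext => p t.
rewrite base_functional_pure /= [X in tensor_map_fun _ _ X]tensor_map_pure.
by rewrite [RHS]tensor_map_pure.
Qed.

Lemma base_dual_exact (P Q T : lmodType R) (f : {linear P -> Q}) (k : {linear Q -> T}) :
  fin_proj P -> fin_proj Q -> fin_proj T ->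
  exact_at (base_map (transpose k)) (base_map (transpose f)) <->
  exact_at (transpose (base_map k)) (transpose (base_map f)).
Proof.
move=> /fin_projP[? [? [? bP]]] /fin_projP[? [? [? bQ]]] /fin_projP[? [? [? bT]]].
have [iP _] := base_dual_bij bP; have [iQ sQ] := base_dual_bij bQ.
have [_ sT] := base_dual_bij bT.
split=> ex x.
  have [z <-] := sQ x; rewrite -base_dual_nat => z0.
  have [|y <-] := ex z; first by apply: iP; rewrite z0 base_dual0.
  by exists (base_dual y); rewrite -base_dual_nat.
move=> x0; have [|y] := ex (base_dual x); first by rewrite -base_dual_nat x0 base_dual0.
have [z <-] := sT y; rewrite -base_dual_nat => /iQ <-.
by exists z.
Qed.
End BaseChange.

(** * The fibre criterion for universal exactness *)

Section Zorn.
Local Open Scope classical_set_scope.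

(** [Zorn_bigcup] also asks for the union of the empty chain, so the empty set is adjoined to [P];
    the member [X0] prevents it from being maximal. *)
Lemma Zorn_nonempty_chain (T : Type) (P : set (set T)) (X0 : set T) :
  P X0 -> ~ P set0 ->
  (forall F : set (set T), F !=set0 -> F `<=` P -> total_on F subset ->
     P (\bigcup_(X in F) X)) ->
  exists X, P X /\ forall Y, X `<=` Y -> P Y -> Y `<=` X.
Proof.
move=> PX0 Pn0 chainP; pose Q : set (set T) := [set X | P X \/ X = set0].
have [|X [QX maxX]] := @Zorn_bigcup T Q.
  move=> F FQ totF.
  have [[X [FX PX]]|noP] := pselect (exists X, F X /\ P X); last first.
    right; rewrite -subset0 => t [X FX Xt].
    by case: (FQ X FX) => [PX|X0']; [apply: noP; exists X | rewrite -X0'].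
  left; have -> : \bigcup_(Y in F) Y = \bigcup_(Y in F `&` P) Y.
    rewrite eqEsubset; split=> t [Y]; last by move=> [FY _] Yt; exists Y.
    move=> FY Yt; exists Y => //; split=> //.
    by case: (FQ Y FY) => // Y0; rewrite Y0 in Yt.
  apply: chainP; [by exists X | by move=> Y [] | ].
  by move=> Y Z [FY _] [FZ _]; exact: totF.
have maxX' Y : X `<=` Y -> P Y -> Y `<=` X.
  move=> XY PY; apply: contrapT => YX; apply: (maxX Y); first by split.
  by left.
case: QX => [PX|X0']; first by exists X.
suff XX0 : X0 = set0 by rewrite XX0 in PX0.
by rewrite -subset0 -X0'; apply: maxX' => //; rewrite X0'; exact: sub0set.
Qed.

Lemma bigcup_ideal (A : comPzRingType) (F : set (set A)) :
  F !=set0 -> (forall X, F X -> is_ideal X) -> total_on F subset ->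
  is_ideal (\bigcup_(X in F) X).
Proof.
move=> [X0 FX0] idF totF; split.
- by exists X0 => //; have [] := idF _ FX0.
- move=> x y [X FX Xx] [Y FY Yy].
  have [XY|YX] := totF _ _ FX FY.
    by exists Y => //; have [_ YD _] := idF _ FY; apply: YD => //; exact: XY.
  by exists X => //; have [_ XD _] := idF _ FX; apply: XD => //; exact: YX.
- move=> a x [X FX Xx]; exists X => //.
  by have [_ _ XM] := idF _ FX; exact: XM.
Qed.

(** The union of a nonempty chain of counterexamples is finitely generated, hence equal to a member
    of the chain; so Zorn's lemma gives a maximal counterexample. *)
Lemma noetherian_ind (A : comPzRingType) (P : set A -> Prop) : noetherian A ->
  (forall I, is_ideal I ->
     (forall J, is_ideal J -> I `<=` J -> ~ J `<=` I -> P J) -> P I) ->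
  forall I, is_ideal I -> P I.
Proof.
move=> noethA stepP I0 idI0; apply: contrapT => nPI0.
pose bad : set (set A) := [set I | is_ideal I /\ ~ P I].
have [|||I [[idI nPI] maxI]] := @Zorn_nonempty_chain A bad I0.
- by split.
- by move=> [[]].
- move=> F F0 Fbad totF.
  have idF X : F X -> is_ideal X by move=> /Fbad[].
  have idU := bigcup_ideal F0 idF totF.
  have [n [g gE]] := noethA _ idU.
  have gU i : (\bigcup_(X in F) X) (g i).
    apply/gE; exists (fun j => (j == i)%:R).
    rewrite (bigD1 i) //= eqxx mul1r big1 ?addr0 // => j /negPf ->.
    by rewrite mul0r.
  have [X [FX Xg]] : exists X, F X /\ forall i, X (g i).
    clear gE; elim: n g gU => [|n IHn] g gU.
      by have [X FX] := F0; exists X; split=> // -[].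
    have [X [FX Xg]] := IHn (fun i => g (widen_ord (leqnSn n) i)) (fun i => gU _).
    have [Y FY Yg] := gU ord_max.
    have gP (Z : set A) : X `<=` Z -> Y `<=` Z -> forall i, Z (g i).
      move=> XZ YZ i; have [i' ->|->] := unliftP ord_max i; last exact: YZ.
      have -> : lift ord_max i' = widen_ord (leqnSn n) i'.
        by apply: val_inj; rewrite /= /bump leqNgt ltn_ord.
      exact/XZ/Xg.
    have [XY|YX] := totF _ _ FX FY.
      by exists Y; split=> //; apply: gP.
    by exists X; split=> //; apply: gP.
  suff -> : \bigcup_(Y in F) Y = X by exact: Fbad.
  rewrite eqEsubset; split=> x; last by exists X.
  move=> /gE[c ->]; have [X00 XD XM] := idF _ FX.
  by apply: (big_ind X) => // i _; exact: XM.
apply: nPI; apply: stepP => // J idJ IJ JI.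
by apply: contrapT => nPJ; apply: JI; apply: maxI.
Qed.

Lemma Spec_eq (A : comPzRingType) (p q : Spec A) : prime_of p = prime_of q -> p = q.
Proof.
case: p q => [p p1 p2 p3] [q q1 q2 q3] /= epq; subst q.
by rewrite (Prop_irrelevance p1 q1) (Prop_irrelevance p2 q2) (Prop_irrelevance p3 q3).
Qed.

(** An ideal maximal among the proper ideals containing [I] is prime, and no other prime contains
    it, so its point is closed. *)
Lemma closed_point_above (A : comPzRingType) (I : set A) :
  is_ideal I -> ~ I 1 -> exists q : Spec A, closed_points q /\ I `<=` prime_of q.
Proof.
move=> idI nI1.
have [|||m [[idm Im nm1] maxm]] := @Zorn_nonempty_chain A
    [set J | [/\ is_ideal J, I `<=` J & ~ J 1]] I.
- by split.
- by move=> [[]].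
- move=> F F0 FP totF; split.
  + by apply: bigcup_ideal => // X /FP[].
  + move=> x Ix; have [X FX] := F0; exists X => //.
    by have [_ IX _] := FP _ FX; exact: IX.
  + by move=> [X FX]; have [_ _] := FP _ FX.
have [m0 mD mM] := idm.
have primem a b : m (a * b) -> m a \/ m b.
  move=> mab; have [|nma] := pselect (m a); [by left | right].
  pose J : set A := [set x | exists y r, m y /\ x = y + r * a].
  have idJ : is_ideal J.
    split.
    - by exists 0, 0; rewrite mul0r addr0.
    - move=> _ _ [y [r [my ->]]] [y' [r' [my' ->]]].
      by exists (y + y'), (r + r'); split; [exact: mD | ring].
    - move=> c _ [y [r [my ->]]].
      by exists (c * y), (c * r); split; [exact: mM | ring].
  have mJ : m `<=` J by move=> x mx; exists x, 0; rewrite mul0r addr0.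
  have [[y [r [my y1]]]|nJ1] := pselect (J 1).
    rewrite -[b]mul1r y1 mulrDl; apply: mD; first by rewrite mulrC; exact: mM.
    by rewrite -mulrA; exact: mM.
  case: nma; apply: (maxm J) => //; last by exists 0, 1; rewrite mul1r add0r.
  by split=> //; apply: subset_trans mJ.
exists (SpecPoint idm nm1 primem); split=> //.
exists m; rewrite eqEsubset; split=> p /=; first by move=> ->.
move=> mp; apply: Spec_eq => /=; rewrite eqEsubset; split=> //.
apply: maxm => //; split; first exact: prime_ideal.
  exact: subset_trans mp.
exact: prime_proper.
Qed.
End Zorn.

(** * Finitely generated kernels and preimages over a coherent ring *)

Section Coherent.
Variable A : comPzRingType.
Hypothesis cohA : coherent_ring A.

(** Coherence presents the image of [f] by some cover [p], not by [q]. As in Schanuel's lemma, lifts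
    [p'] and [q'] between the two covers show that the kernel of [q] is generated by the v - p'(q'
    v) and the image under [p'] of the kernel of [p]. *)
Lemma kernel_form_fin_gen m (f : {linear 'rV[A]_m -> A^o}) :
  exists l (u : {linear 'rV[A]_l -> 'rV[A]_m}), forall x, f x = 0 <-> exists y, u y = x.
Proof.
have [q qE] := factor_inj (f := f) (sub_inj_inj (img f))
  (fun u => iffLR (sub_injP (img f) (f u)) (ex_intro _ u erefl)).
have sq : surjective q.
  move=> y; have /sub_injP[x fx] : exists u : submod_type (img f),
    sub_inj u = sub_inj y by exists y.
  by exists x; apply: (sub_inj_inj (img f)); rewrite qE.
have [_ /(_ _ _ (sub_inj_inj (img f)))[]] := cohA.
  by exists m, q.
move=> a [b [g [p [sp kp]]]].
have [p' p'E] := proj2 (fin_proj_row A b) _ _ q p sq.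
have [q' q'E] := proj2 (fin_proj_row A m) _ _ p q sp.
have lu : linear (fun v : 'rV[A]_(m + a) =>
    (lsubmx v - p' (q' (lsubmx v))) + p' (g (rsubmx v))).
  move=> c u v; rewrite !linearP /= !scalerDr.
  by rewrite [X in X + _]addrACA [LHS]addrACA.
exists (m + a)%N, (mklin lu) => x.
have fq : f x = 0 <-> q x = 0.
  rewrite -qE; split=> [|->]; last exact: linear0.
  by move=> q0; apply: (sub_inj_inj (img f)); rewrite q0 linear0.
rewrite fq; split=> [qx|[v <-]] /=.
  have /kp[y yE] : p (q' x) = 0 by rewrite q'E.
  by exists (row_mx x y); rewrite /= row_mxKl row_mxKr yE subrK.
rewrite linearD linearB !p'E q'E subrr add0r.
by apply/kp; exists (rsubmx v).
Qed.

(** Induction on the number of coordinates: the kernel of the first is covered by [u], along which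
    the others are restricted. *)
Lemma kernel_fin_gen m k (f : {linear 'rV[A]_m -> 'rV[A]_k}) :
  exists l (u : {linear 'rV[A]_l -> 'rV[A]_m}), forall x, f x = 0 <-> exists y, u y = x.
Proof.
elim: k m f => [|k IHk] m f.
  exists m, idfun => x; split=> [_|_]; first by exists x.
  by apply/rowP => -[].
have lf0 : linear (fun x : 'rV[A]_m => f x 0 ord0 : A^o).
  by move=> a x y; rewrite linearP !mxE.
have [l [u uE]] := kernel_form_fin_gen (mklin lf0).
have lf1 : linear (fun y : 'rV[A]_l => \row_i f (u y) 0 (lift ord0 i)).
  by move=> a x y; apply/rowP => i; rewrite !linearP !mxE.
have [l' [u' u'E]] := IHk _ (mklin lf1).
have luu : linear (fun y => u (u' y)) by move=> a x y; rewrite !linearP.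
exists l', (mklin luu) => x; split=> [fx|[y <-]] /=.
  have [|y yx] := iffLR (uE x); first by rewrite /= fx mxE.
  have [|z zy] := iffLR (u'E y); last by exists z; rewrite zy.
  by apply/rowP => i; rewrite /= yx fx !mxE.
apply/rowP => i; have [j ->|->] := unliftP ord0 i.
  have /rowP/(_ j) := iffRL (u'E (u' y)) (ex_intro _ y erefl).
  by rewrite !mxE.
by rewrite [LHS](iffRL (uE (u (u' y))) (ex_intro _ _ erefl)) mxE.
Qed.

(** The preimage is the projection of a fibre product, which is the kernel of a map between free
    modules once [C] is embedded in a free module by [j]. *)
Lemma preimage_fin_gen (B C : lmodType A) (k : {linear B -> C}) l
    (psi : {linear 'rV[A]_l -> C}) : fin_gen B -> fin_proj C ->
  exists r (e : 'I_r -> B), (forall i, exists y, psi y = k (e i)) /\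
    forall x, (exists y, psi y = k x) -> exists v, row_map e v = x.
Proof.
move=> [m [p sp]] [[c [pc spc]] /(_ _ _ pc idfun spc)[j jE]].
have inj_j : injective j by exact: (can_inj jE).
have lF : linear (fun v : 'rV[A]_(m + l) => j (k (p (lsubmx v)) - psi (rsubmx v))).
  move=> a u v; rewrite -[RHS]linearP; congr (j _).
  by rewrite !linearP [in RHS]scalerDr addrACA.
have [r [u uE]] := kernel_fin_gen (mklin lF).
exists r, (fun i => p (lsubmx (u (delta_mx 0 i)))); split=> [i|x [y yE]].
  exists (rsubmx (u (delta_mx 0 i))); apply/esym/eqP; rewrite -subr_eq0.
  apply/eqP/inj_j.
  by rewrite linear0; apply: (iffRL (uE _)); eexists.
have [w wx] := sp x.
have [|v vE] := iffLR (uE (row_mx w y)).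
  by rewrite /= row_mxKl row_mxKr wx yE subrr linear0.
have lpl : linear (fun v => p (lsubmx (u v))) by move=> a s t; rewrite !linearP.
exists v; rewrite -[LHS](linear_rowE (mklin lpl)) /= vE row_mxKl.
exact: wx.
Qed.
End Coherent.

(* The generators are eliminated one at a time, so no localization at q is
   needed: rho is the common denominator. *)
Lemma nakayama (R : comPzRingType) (B : lmodType R) (U : submod B) (q : Spec R) r
    (e : 'I_r -> B) :
  (forall i, exists rho (v : 'I_r -> R), [/\ ~ prime_of q rho,
     forall j, prime_of q (v j) & U (rho *: e i - \sum_j v j *: e j)]) ->
  exists rho, ~ prime_of q rho /\ forall i, U (rho *: e i).
Proof.
have UN x : U x -> U (- x) by rewrite -scaleN1r; exact: sub_predZ.
elim: r e => [|r IHr] e He; first by exists 1; split=> [|[]//]; exact: prime_proper.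
have [rl [vl [qrl qvl]]] := He ord_max.
rewrite big_ord_recr /=; set w := widen_ord _ => Ul.
(* The last relation is solved for [e ord_max], whose coefficient [s] stays outside [q];
   substituting it multiplies the other relations by [s]. *)
pose s := rl - vl ord_max.
have qs : ~ prime_of q s.
  by move=> qs; apply: qrl; rewrite -(subrK (vl ord_max) rl); apply: primeD.
have {}Ul : U (s *: e ord_max - \sum_(j < r) vl (w j) *: e (w j)).
  by move: Ul; rewrite scalerBl opprD addrA addrAC.
have [i|rho [qrho Urho]] := IHr (e \o w).
  have [ri [vi [qri qvi]]] := He (w i); rewrite big_ord_recr /= -/w => Ui.
  exists (s * ri), (fun j => s * vi (w j) + vi ord_max * vl (w j)); split.
  - exact: primeNM.
  - by move=> j; apply: primeD; apply: primeMl.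
  have -> : \sum_j (s * vi (w j) + vi ord_max * vl (w j)) *: (e \o w) j =
      s *: (\sum_(j < r) vi (w j) *: e (w j)) +
      vi ord_max *: (\sum_(j < r) vl (w j) *: e (w j)).
    rewrite !scaler_sumr -big_split; apply: eq_bigr => j _ /=.
    by rewrite scalerDl !scalerA.
  have := sub_predD (sub_predZ s Ui) (sub_predZ (vi ord_max) Ul).
  rewrite !scalerBr scalerDr opprD !scalerA [vi ord_max * s]mulrC !addrA subrK.
  by rewrite opprD addrA.
exists (rho * s); split; first exact: primeNM.
move=> i; have [j ->|->] := unliftP ord_max i.
  have -> : lift ord_max j = w j by apply: val_inj; rewrite /= /bump leqNgt ltn_ord.
  by rewrite mulrC -scalerA; apply: sub_predZ; exact: Urho.
rewrite -scalerA -(subrK (\sum_(j < r) vl (w j) *: e (w j)) (s *: _)) scalerDr.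
apply: sub_predD; first exact: sub_predZ.
rewrite scaler_sumr; apply: (big_ind U); [exact: sub_pred0|exact: sub_predD|].
by move=> j _; rewrite scalerA mulrC -scalerA; apply/sub_predZ/Urho.
Qed.

(** * From exact fibres to exactness modulo every ideal *)

Section FibreCriterion.
Variables (S R : comPzRingType) (h : {rmorphism S -> R}).
Variables (A B C : lmodType R) (f : {linear A -> B}) (k : {linear B -> C}).
Hypothesis kf : forall x, k (f x) = 0.

Section Fibre.
Variable s : Spec S.
Local Notation K := (residue_field s).
Local Notation g := (residue_map s).

Lemma residue_map_eq0 (t : S) : g t = 0 <-> prime_of s t.
Proof.
rewrite -[0 in X in X <-> _](rmorph0 g) residue_eqP.
by rewrite /num /den /= mulr1 mul0r subr0.
Qed.

(** Denominators of the residue field are cleared term by term, and [t] is their product. *)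
Lemma fibre_fraction (M : lmodType R) (x : tens h g M K^o) :
  exists t m, ~ prime_of s t /\
    base_hom h g (g t) *: (x : tensor h g M K^o) = pure h g m (1 : K^o).
Proof.
elim/tens_ind: x => [|x y [t [m [nt tx]]] [t' [m' [nt' ty]]]|m q].
- by exists 1, 0; split; [exact: prime_proper | rewrite scaler0 pure0l].
- exists (t * t'), (h t' *: m + h t *: m'); split; first exact: primeNM.
  rewrite scalerDr !rmorphM pureDl !pureZ; congr (_ + _).
    by rewrite mulrC -scalerA tx; exact: base_hom_scale_pure.
  by rewrite -scalerA ty; exact: base_hom_scale_pure.
elim/quotW: q => q; exists (den q), (h (num q) *: m); split; first exact: denP.
rewrite [LHS]base_hom_scale_pure pureZ; congr pure.
rewrite -[RHS]/(residueM _ _) -[LHS]/(residueM _ _) !residueM_pi.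
apply/residue_eqP.
rewrite -[X in prime_of s X]/(den q * num q * (1 * 1) - num q * 1 * (1 * den q)).
by rewrite (_ : _ - _ = 0); [exact: prime0 | ring].
Qed.

(** Clearing denominators in a preimage of e ⊗ 1 gives (t e - f y) ⊗ 1 = 0 in the fibre. The
    annihilator of 1 in the residue field is the prime [s], so flatness of [B] concludes. *)
Lemma fibre_exact_local : flat_over h B ->
  exact_at (tensor_map h g f (idM K^o)) (tensor_map h g k (idM K^o)) ->
  forall e, imul h (prime_of s) (k e) ->
  exists t y, ~ prime_of s t /\ imul h (prime_of s) (h t *: e - f y).
Proof.
move=> flatB exs e ske.
have [|z zE] := exs (pure h g e (1 : K^o)).
  rewrite [LHS]tensor_map_pure; elim: ske => [|x y _ IHx _ IHy|t x st].
  - exact: pure0l.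
  - by rewrite pureDl IHx IHy addr0.
  by rewrite pureZ (iffRL (residue_map_eq0 t) st) scale0r pure0r.
have [t [y [nt tz]]] := fibre_fraction z.
exists t, y; split=> //.
have pure0 : pure h g (h t *: e - f y) (1 : K^o) = 0.
  rewrite pureDl pureZ.
  have <- : base_hom h g (g t) *: (pure h g e (1 : K^o) : tensor h g B K^o) =
      pure h g e (g t *: (1 : K^o)) by exact: base_hom_scale_pure.
  rewrite -zE -[_ *: _]linearZ /= tz [X in X + _]tensor_map_pure.
  by rewrite -[X in X + _ = _]/(pure h g (f y) (1 : K^o)) -pureDl subrr pure0l.
move/(congr1 (@to_restr _ _ _ h g B K^o)): pure0; rewrite to_restr_pure to_restr0.
move=> /(flat_pure_eq0 flatB); apply: imulS => u.
rewrite /ann -[u *: _]/(g u * 1) mulr1.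
exact: (iffLR (residue_map_eq0 u)).
Qed.
End Fibre.

Definition ideal_submod (a : set S) (ida : is_ideal a) : submod S^o.
Proof. by exists a; case: ida. Defined.

Lemma submod_ideal (a : submod S^o) : is_ideal (a : set S).
Proof.
split; [exact: sub_pred0 | by move=> x y; exact: sub_predD |].
by move=> x y; exact: (@sub_predZ _ _ a x).
Qed.

(** The generators of [a] make aM an image of M^n, hence of the n × m matrices, row i being the
    coefficients of the i-th component. *)
Lemma imul_ideal (M : lmodType R) n (g : 'I_n -> S) (a : set S) :
  (forall x, a x <-> exists c : 'I_n -> S, x = \sum_(i < n) c i * g i) ->
  fin_gen M ->
  exists l (psi : {linear 'rV[R]_l -> M}), forall x, imul h a x <-> exists y, psi y = x.
Proof.
move=> aE [m [p sp]].
have lpsi : linear (fun v : 'rV[R]_(n * m) =>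
    \sum_(i < n) h (g i) *: p (row i (vec_mx v))).
  move=> c u v; rewrite scaler_sumr -big_split; apply: eq_bigr => i _ /=.
  by rewrite !linearP.
exists (n * m)%N, (mklin lpsi) => x; split=> [|[v <-]] /=; last first.
  apply: (big_ind (imul h a)) => [||i _]; [exact: imul0|exact: imulD|].
  apply: imulM; apply/aE; exists (fun j => (j == i)%:R).
  rewrite (bigD1 i) //= eqxx mul1r big1 ?addr0 // => j /negPf ->.
  by rewrite mul0r.
elim=> {x} [|x y _ [u <-] _ [v <-]|s x /aE[c ->]].
- by exists 0; exact: (linear0 (mklin lpsi)).
- by exists (u + v); exact: (linearD (mklin lpsi)).
have [w <-] := sp x.
exists (mxvec (\matrix_i (h (c i) *: w))) => /=.
rewrite rmorph_sum scaler_suml; apply: eq_bigr => i _.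
by rewrite mxvecK rowK linearZ rmorphM scalerA mulrC.
Qed.

Hypothesis flat_h : flat_hom h.
Hypothesis noethS : noetherian S.
Hypothesis cohR : coherent_ring R.
Hypotheses (fpB : fin_proj B) (fpC : fin_proj C).

Lemma all_exact_mod_of_fibres :
  (forall s, closed_image h s ->
     exact_at (tensor_map h (residue_map s) f (idM (residue_field s)^o))
              (tensor_map h (residue_map s) k (idM (residue_field s)^o))) ->
  all_exact_mod h f k.
Proof.
move=> exs; have flatB := fin_proj_flat flat_h fpB.
have flatC := fin_proj_flat flat_h fpC.
suff main (a : set S) : is_ideal a -> exact_mod h f k a.
  by move=> a; exact/main/submod_ideal.
move: a; apply: (noetherian_ind noethS) => a ida IH.
have [a1|na1] := pselect (a 1).
  by move=> e _; exists 0; rewrite linear0 subr0 -[e]scale1r -(rmorph1 h); exact: imulM.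
have [a0 aD aM] := ida.
pose colon (t : S) : set S := [set x | a (x * t)]%classic.
have colonP t (c : C) : imul h a (h t *: c) -> imul h (colon t) c.
  exact: (@flat_colon S R h C (ideal_submod ida) t c flatC).
pose plus (t : S) : set S := [set x | exists y r, a y /\ x = y + r * t]%classic.
have id_plus t : is_ideal (plus t).
  split.
  - by exists 0, 0; rewrite mul0r addr0.
  - move=> _ _ [y [r [ay ->]]] [y' [r' [ay' ->]]].
    by exists (y + y'), (r + r'); split; [exact: aD | ring].
  - move=> c _ [y [r [ay ->]]].
    by exists (c * y), (c * r); split; [exact: aM | ring].
have id_colon t : is_ideal (colon t).
  rewrite /colon; split=> /=; first by rewrite mul0r.
    by move=> x y ax ay; rewrite mulrDl; exact: aD.
  by move=> c x ax; rewrite -mulrA; exact: aM.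
have a_plus t : (a `<=` plus t)%classic.
  by move=> x ax; exists x, 0; rewrite mul0r addr0.
have imul_plus t (c : B) : imul h (plus t) c -> exists c', imul h a (c - h t *: c').
  elim=> [|x y _ [x' x'P] _ [y' y'P]|_ x [y [r [ay ->]]]].
  - by exists 0; rewrite scaler0 subr0; exact: imul0.
  - by exists (x' + y'); rewrite scalerDr opprD addrACA; exact: imulD.
  - exists (h r *: x); rewrite rmorphD scalerDl rmorphM scalerA [h r * _]mulrC addrK.
    exact: imulM.
(* Exactness modulo a + (t) writes [e] as f y + t e' modulo aB; then t k(e') lies in aC, and
   flatness of [C] puts k(e') in (a : t)C. *)
have split_plus t e : ~ a t -> imul h a (k e) ->
    exists y e', imul h (colon t) (k e') /\ imul h a (e - f y - h t *: e').
  move=> nat ake.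
  have [|y yP] := IH _ (id_plus t) (a_plus t) _ e (imulS (a_plus t) ake).
    by move=> sub; apply/nat/sub; exists 0, 1; rewrite mul1r add0r.
  have [e' e'P] := imul_plus _ _ yP.
  exists y, e'; split=> //; apply: colonP.
  rewrite -linearZ -[_ *: _](subKr (e - f y)) linearB linearB kf subr0.
  by apply: imulB => //; exact: imul_linear.
(* If [a] is not prime, both a + (t) and the colon ideal, which contains [u], are strictly larger
   than [a]. The error in (a : t)B left for [e'] is multiplied by [t] into aB. *)
have [[t [u [atu nat nau]]]|prime_a] :=
    pselect (exists t u, [/\ a (t * u), ~ a t & ~ a u]).
  move=> e ake; have [y [e' [ke' yP]]] := split_plus t e nat ake.
  have [||z zP] := IH _ (id_colon t) _ _ e' ke'.
  - by move=> x ax /=; rewrite /colon /= mulrC; exact: aM.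
  - by move=> sub; apply/nau/sub; rewrite /colon /= mulrC.
  exists (y + h t *: z).
  have -> : e - f (y + h t *: z) = (e - f y - h t *: e') + h t *: (e' - f z).
    by rewrite linearD linearZ scalerBr opprD !addrA subrK.
  apply: imulD => //; elim: zP => [|x x' _ IHx _ IHx'|r x rt].
  - by rewrite scaler0; exact: imul0.
  - by rewrite scalerDr; exact: imulD.
  - by rewrite scalerA -rmorphM mulrC; exact: imulM.
(* From here on a is prime.  Coherence makes T = k^-1(aC) finitely generated, and
   the multipliers of T into U = f A + a B form an ideal J.  If J is proper, it
   lies in a maximal ideal q; T = U + q T holds up to denominators outside q
   because of the fibre at h^-1(q) if h^-1(q) = a, and because of exactness
   modulo a + (t) with t in h^-1(q) \ a otherwise. *)
have U0 : exists y, imul h a ((0 : B) - f y).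
  by exists 0; rewrite linear0 subrr; exact: imul0.
have UD x x' : (exists y, imul h a (x - f y)) -> (exists y, imul h a (x' - f y)) ->
    exists y, imul h a (x + x' - f y).
  move=> [y yP] [y' y'P]; exists (y + y'); rewrite linearD opprD addrACA.
  exact: imulD.
have UZ c x : (exists y, imul h a (x - f y)) -> exists y, imul h a (c *: x - f y).
  by move=> [y yP]; exists (c *: y); rewrite linearZ -scalerBr; exact: imulZ.
pose U : submod B := Submod U0 UD UZ.
have imulU x : imul h a x -> U x by move=> ax; exists 0; rewrite linear0 subr0.
have [n [g gE]] := noethS ida.
have [l [psi psiE]] := imul_ideal gE (proj1 fpC).
have [r [e [eT eP]]] := preimage_fin_gen cohR k psi (proj1 fpB) fpC.
have ake i : imul h a (k (e i)) by exact/psiE/eT.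
have gen x : imul h a (k x) -> exists v, row_map e v = x by move=> /psiE/eP.
pose J : set R := [set rho | forall i, U (rho *: e i)]%classic.
have idJ : is_ideal J.
  split=> [i|x y Jx Jy i|c x Jx i]; first by rewrite scale0r; exact: sub_pred0.
    by rewrite scalerDl; apply: sub_predD.
  by rewrite -scalerA; apply: sub_predZ.
have [J1|nJ1] := pselect (J 1).
  move=> x /gen[v <-]; apply: (big_ind U) => [||i _].
  - exact: (sub_pred0 U).
  - exact: (@sub_predD _ _ U).
  - by apply: (@sub_predZ _ _ U); rewrite -[e i]scale1r; exact: J1.
have [q [clq Jq]] := closed_point_above idJ nJ1.
pose s := Spec_map h q.
have cls : closed_image h s by exists q.
(* The image of [a] under [h] multiplies every e_i into aB, so it lies in [J] and hence in [q]. *)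
have a_s x : a x -> prime_of s x.
  by move=> ax; apply: Jq => i; apply: imulU; exact: imulM.
suff [rho [qrho Jrho]] : exists rho, ~ prime_of q rho /\ forall i, U (rho *: e i).
  by case: qrho; exact: Jq.
apply: nakayama => i.
have [s_a|/existsNP[t /not_implyP[st nat]]] := pselect (forall t, prime_of s t -> a t).
  have [t [y [nst yP]]] := fibre_exact_local flatB (exs s cls) (imulS a_s (ake i)).
  exists (h t), (fun=> 0); split=> //; first by move=> _; exact: prime0.
  rewrite big1 ?subr0 => [|j _]; last by rewrite scale0r.
  by exists y; exact: imulS yP.
have [y [e' [ke' yP]]] := split_plus t (e i) nat (ake i).
(* As [a] is prime and [t] is not in it, the colon ideal is contained in [a]; so [e'] is again a
   combination of the e_j, and the factor [t] puts the coefficients in [q]. *)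
have [v vE] : exists v, row_map e v = e'.
  apply: gen; apply: imulS ke' => x axt.
  by apply: contrapT => nax; apply: prime_a; exists x, t; split.
exists 1, (fun j => h t * v 0 j); split; first exact: prime_proper.
  by move=> j; rewrite mulrC; exact: primeMl.
have -> : \sum_j (h t * v 0 j) *: e j = h t *: e'.
  by rewrite -vE /= scaler_sumr; apply: eq_bigr => j _; rewrite scalerA.
by exists y; rewrite scale1r addrAC.
Qed.
End FibreCriterion.

(** * Construction of a hull *)

Section FreeHull.
Variable A : comPzRingType.

Section MatrixDual.
Variables (m k l : nat) (D : 'M[A]_(m, k)) (D' : 'M[A]_(k, l)).

(** A functional on a free module is the row of its values on the basis, on which the transposed map
    acts by the transposed matrix. *)
Lemma dual_exact_mx :
  (forall v : 'rV_k, v *m D^T = 0 -> exists w : 'rV_l, w *m D'^T = v) ->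
  exact_at (transpose (mulmxr D' : {linear 'rV_k -> 'rV_l}))
           (transpose (mulmxr D : {linear 'rV_m -> 'rV_k})).
Proof.
move=> exD phi phiD.
have phiE x : hom_fun phi x = \sum_i x 0 i *: hom_fun phi (delta_mx 0 i).
  exact: (linear_rowE (hom_fun phi)).
have [|w wE] := exD (\row_i (hom_fun phi (delta_mx 0 i))).
  apply/rowP => j; move/(congr1 (fun f => hom_fun f (delta_mx 0 j))): phiD.
  rewrite /= phiE => e; rewrite [RHS]mxE -[RHS]e mxE; apply: eq_bigr => i _.
  by rewrite -rowE !mxE; exact: mulrC.
have lpsi : linear (fun x : 'rV[A]_l => (x *m w^T) 0 0 : A^o).
  by move=> a x y; rewrite mulmxDl -scalemxAl !mxE.
exists (mklin lpsi); apply: homP => x /=.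
have -> : x *m D' *m w^T = x *m (\row_i (hom_fun phi (delta_mx 0 i)))^T.
  by rewrite -wE trmx_mul trmxK mulmxA.
by rewrite phiE mxE; apply: eq_bigr => i _; rewrite !mxE.
Qed.
End MatrixDual.

Section KernelSequence.
Hypothesis cohA : coherent_ring A.

Lemma kernel_mx_ex m k (D : 'M[A]_(m, k)) :
  exists lU : {l & 'M[A]_(l, m)}, forall x : 'rV_m,
    x *m D = 0 <-> exists y, y *m projT2 lU = x.
Proof.
have [l [u uE]] := kernel_fin_gen cohA (mulmxr D : {linear 'rV_m -> 'rV_k}).
exists (existT _ l (lin1_mx u)) => x; split=> [/uE[y <-]|[y <-]].
  by exists y; rewrite mul_rV_lin1.
by rewrite mul_rV_lin1; apply/uE; exists y.
Qed.

Definition kernel_mx m k (D : 'M[A]_(m, k)) := sval (cid (kernel_mx_ex D)).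

Lemma kernel_mxP m k (D : 'M[A]_(m, k)) (x : 'rV_m) :
  x *m D = 0 <-> exists y, y *m projT2 (kernel_mx D) = x.
Proof. exact: (svalP (cid (kernel_mx_ex D))). Qed.

Variables (m0 k0 : nat) (D0 : 'M[A]_(m0, k0)).

(** The sizes arise along the recursion, so they are carried with the matrix; [syz_dim] then makes
    the sizes of consecutive matrices match by conversion. *)
Fixpoint syzygy (j : nat) : {m & {k & 'M[A]_(m, k)}} :=
  if j is i.+1 then
    let D := projT2 (projT2 (syzygy i)) in
    existT (fun m => {k & 'M_(m, k)}) (projT1 (kernel_mx D))
      (existT (fun k => 'M_(_, k)) _ (projT2 (kernel_mx D)))
  else existT _ m0 (existT _ k0 D0).

Definition syz_dim (j : nat) : nat := if j is i.+1 then projT1 (syzygy i) else k0.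

(* ... -> A^(syz_dim 2) -> A^m0 -> A^k0, where D0 is the last arrow. *)
Definition syz_mx (j : nat) : 'M[A]_(syz_dim j.+1, syz_dim j) :=
  match j return 'M[A]_(syz_dim j.+1, syz_dim j) with
  | 0 => D0
  | i.+1 => projT2 (projT2 (syzygy i.+1))
  end.

Lemma syz_mxP j (x : 'rV_(syz_dim j.+1)) :
  x *m syz_mx j = 0 <-> exists y, y *m syz_mx j.+1 = x.
Proof. by case: j x => [|j] x; exact: kernel_mxP. Qed.

Lemma syz_mx_comp j : syz_mx j.+1 *m syz_mx j = 0.
Proof.
apply/row_matrixP => i; rewrite row0 row_mul; apply/syz_mxP.
by exists (delta_mx 0 i); rewrite rowE.
Qed.
End KernelSequence.

Section Complex.
Hypothesis cohA : coherent_ring A.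
Variables (n0 n1 : nat) (P : 'M[A]_(n1, n0)).

Local Notation dn := (syz_dim cohA P).
Local Notation up := (syz_dim cohA P^T).

(* A free resolution of coker P in degrees <= 0, continued by the transpose of a
   free resolution of the dual of coker P, which is the kernel of P^T. *)
Definition hull_dim (i : int) : nat :=
  match i with Posz a => up a.+1 | Negz a => dn a.+1 end.

(** The target degree is arbitrary, so [conform_mx] casts the matrix to its size; the test on [j]
    ensures that the sizes agree and the default 0 is not reached. *)
Definition hull_mx (i j : int) : 'M[A]_(hull_dim i, hull_dim j) :=
  match i return 'M[A]_(hull_dim i, hull_dim j) with
  | Posz a => if j == a.+1%:Z then conform_mx 0 (syz_mx cohA P^T a.+1)^T else 0
  | Negz 0 => if j == 0 then conform_mx 0 P else 0
  | Negz a.+1 => if j == Negz a then conform_mx 0 (syz_mx cohA P a.+1) else 0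
  end.

Local Arguments hull_mx : simpl never.

Lemma hull_mx_pos a : hull_mx (Posz a) (Posz a.+1) = (syz_mx cohA P^T a.+1)^T.
Proof. by rewrite /hull_mx eqxx conform_mx_id. Qed.
Lemma hull_mx_neg1 : hull_mx (Negz 0) (Posz 0) = P.
Proof. by rewrite /hull_mx eqxx conform_mx_id. Qed.
Lemma hull_mx_neg a : hull_mx (Negz a.+1) (Negz a) = syz_mx cohA P a.+1.
Proof. by rewrite /hull_mx eqxx conform_mx_id. Qed.

Lemma NegzS a : Negz a.+1 + 1 = Negz a.
Proof. by rewrite !NegzE; lia. Qed.

Lemma hull_mx_shape i j : j != i + 1 -> hull_mx i j = 0.
Proof.
case: i => [a|[|a]] ji; rewrite /hull_mx; case: eqP => // jE; move: ji; rewrite jE.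
- by rewrite intS addrC eqxx.
- by move/eqP/(_ erefl).
- by rewrite NegzS eqxx.
Qed.

Lemma hull_mx_comp i j l : hull_mx i j *m hull_mx j l = 0.
Proof.
have [ij|/hull_mx_shape ->] := eqVneq j (i + 1); last by rewrite mul0mx.
have [jl|/hull_mx_shape ->] := eqVneq l (j + 1); last by rewrite mulmx0.
case: i ij => [a|[|[|a]]] ij.
- have {}ij : j = Posz a.+1 by rewrite ij; lia.
  have {}jl : l = Posz a.+2 by rewrite jl ij; lia.
  by subst j l; rewrite !hull_mx_pos -trmx_mul syz_mx_comp trmx0.
- have {}ij : j = Posz 0 by rewrite ij.
  have {}jl : l = Posz 1 by rewrite jl ij.
  subst j l; rewrite hull_mx_neg1 hull_mx_pos.
  have /(congr1 trmx) : syz_mx cohA P^T 1 *m P^T = 0 by exact: (syz_mx_comp cohA P^T 0).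
  by rewrite trmx_mul trmxK trmx0.
- have {}ij : j = Negz 0 by rewrite ij NegzS.
  have {}jl : l = Posz 0 by rewrite jl ij.
  by subst j l; rewrite hull_mx_neg hull_mx_neg1 (syz_mx_comp cohA P 0).
- have {}ij : j = Negz a.+1 by rewrite ij NegzS.
  have {}jl : l = Negz a by rewrite jl ij NegzS.
  by subst j l; rewrite !hull_mx_neg syz_mx_comp.
Qed.

Fact hull_diff_shape i j : j != i + 1 -> forall x : 'rV_(hull_dim i),
  (mulmxr (hull_mx i j) : {linear _ -> _}) x = 0.
Proof. by move=> /hull_mx_shape e x; rewrite /= e mulmx0. Qed.
Fact hull_diff_sq i j l (x : 'rV_(hull_dim i)) :
  (mulmxr (hull_mx j l) : {linear _ -> _})
    ((mulmxr (hull_mx i j) : {linear _ -> 'rV_(hull_dim j)}) x) = 0.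
Proof. by rewrite /= -mulmxA hull_mx_comp mulmx0. Qed.

Definition free_complex : cochain_complex A :=
  CochainComplex (cobj := fun i => 'rV[A]_(hull_dim i)) hull_diff_shape hull_diff_sq.

Lemma free_complex_exact j : j <= -1 -> exact_deg free_complex j.
Proof.
case: j => // a _ b c ab bc; have {}ab : b = Negz a.+1 by move: ab; lia.
case: a ab bc => [|a] -> bc x.
  have {}bc : c = Posz 0 by rewrite -bc.
  subst c; rewrite /= hull_mx_neg hull_mx_neg1.
  exact: (iffLR (@syz_mxP cohA _ _ P 0 x)).
have {}bc : c = Negz a by rewrite -bc NegzS.
subst c; rewrite /= !hull_mx_neg; exact: (iffLR (@syz_mxP cohA _ _ P a.+1 x)).
Qed.

Lemma free_complex_dual_exact j : 0 <= j -> dual_exact_deg free_complex j.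
Proof.
case: j => // a _ b c ab ac; have {}ac : c = Posz a.+1 by move: ac; lia.
subst c; apply: dual_exact_mx => v; rewrite hull_mx_pos trmxK.
case: a ab v => [|a] ab v.
  have {}ab : b = Negz 0 by move: ab; lia.
  subst b; rewrite hull_mx_neg1; exact: (iffLR (@syz_mxP cohA _ _ P^T 0 v)).
have {}ab : b = Posz a by move: ab; lia.
subst b; rewrite hull_mx_pos trmxK; exact: (iffLR (@syz_mxP cohA _ _ P^T a.+1 v)).
Qed.
End Complex.

Lemma free_hull (M : lmodType A) : coherent_ring A -> coherent M ->
  exists E : cochain_complex A, [/\ hull E M,
    forall j, j <= -1 -> exact_deg E j & forall j, 0 <= j -> dual_exact_deg E j].
Proof.
(* Coherence applied to [M] as a submodule of itself gives the finite presentation from which the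
   complex starts. *)
move=> cohA [fgM /(_ M idfun (fun x y e => e) fgM)[n1 [n0 [u [p [sp kp]]]]]].
exists (free_complex cohA (lin1_mx u)); split.
- apply/hullP; split=> [i|]; first exact: fin_proj_row.
  exists p; split=> // x; rewrite kp /= conform_mx_id.
  by split=> -[y <-]; exists y; rewrite mul_rV_lin1.
- exact: free_complex_exact.
- exact: free_complex_dual_exact.
Qed.
End FreeHull.

(** * Universally exact complexes *)

Section ExactTransfer.
Variables (S R : comPzRingType) (h : {rmorphism S -> R}).

Lemma uexact_iso (A B C A' B' C' : lmodType R)
    (f : {linear A -> B}) (k : {linear B -> C})
    (f' : {linear A' -> B'}) (k' : {linear B' -> C'})
    (u : {linear A -> A'}) (v : {linear B -> B'}) (w : {linear C -> C'}) :
  injective v -> surjective v -> injective w -> surjective w ->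
  (forall x, f' (u x) = v (f x)) -> (forall x, k' (v x) = w (k x)) ->
  uexact h f k -> uexact h f' k'.
Proof.
move=> iv sv iw sw fE kE ex N x kx.
have [v' v'K] := factor_inj (f := idfun) iv sv.
have [w' w'K] := factor_inj (f := idfun) iw sw.
have v'k y : w' (k' y) = k (v' y) by apply: iw; rewrite w'K -kE v'K.
pose vx := tensor_map h (idS S) v' (idM N) x.
have [|y yE] := ex N vx.
  have wk (g : {linear B' -> C}) : (forall y, g y = w' (k' y)) ->
      tensor_map h (idS S) g (idM N) x = 0.
    move=> gE; rewrite -(tensor_map_comp h (idS S) k' w' g idfun idfun idfun) //.
    by rewrite kx linear0.
  have lg : linear (fun y => k (v' y)) by move=> a s t; rewrite !linearP.
  rewrite (tensor_map_comp h (idS S) v' k (mklin lg) idfun idfun idfun) //.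
  by apply: wk => y; rewrite v'k.
exists (tensor_map h (idS S) u (idM N) y).
have lg : linear (fun y => v (f y)) by move=> a s t; rewrite !linearP.
rewrite (tensor_map_comp h (idS S) u f' (mklin lg) idfun idfun idfun) //.
rewrite -(tensor_map_comp h (idS S) f v (mklin lg) idfun idfun idfun) //.
rewrite yE (tensor_map_comp h (idS S) v' v idfun idfun idfun idfun) //.
exact: tensor_map_id.
Qed.

(* Diagram chase with 0 -> N -> N1 -> coker i -> 0. *)
Lemma flat_of_uexact (A B C M : lmodType R) (f : {linear A -> B})
    (k : {linear B -> C}) (p : {linear C -> M}) :
  flat_over h C -> (forall x, k (f x) = 0) ->
  surjective p -> (forall x, p x = 0 <-> exists y, k y = x) ->
  uexact h f k -> flat_over h M.
Proof.
move=> flatC kf sp kp ex N N1 i inj_i.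
suff i0 x : tensor_map h (idS S) (idM M) i x = 0 -> x = 0.
  move=> x y xy; apply/eqP; rewrite -subr_eq0; apply/eqP/i0.
  by rewrite linearB xy subrr.
have [c <-] := tensor_surj (h := h) (g := idS S) (N := N) sp x.
rewrite (tensor_map_comp h (idS S) p idfun p (idM N) i i) //.
rewrite -(tensor_map_comp h (idS S) idfun p p i (idM N1) i) //.
move=> /(tensor_right_exact sp kp)[b bE].
pose q := coker_pi i; have sq := coker_pi_surj i; have kq := @coker_pi0 _ _ _ i.
have kq0 : tensor_map h (idS S) k (idM (coker i))
    (tensor_map h (idS S) (idM B) q b) = 0.
  rewrite (tensor_map_comp h (idS S) idfun k k q idfun q) //.
  rewrite -(tensor_map_comp h (idS S) k idfun k idfun q q) //.
  rewrite bE; apply/(proj2 (tensor_right_exact_r h (idS S) C sq kq)).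
  by exists c.
(* With coefficients in the cokernel of [i], the image of [b] is a cocycle, hence a coboundary;
   subtracting a lift of it moves [b] into the image of B ⊗ N without changing its image under
   [k]. *)
have [a aE] := ex _ _ kq0.
have [a' a'E] := proj1 (tensor_right_exact_r h (idS S) A sq kq) a.
have [|b' b'E] := iffLR (proj2 (tensor_right_exact_r h (idS S) B sq kq)
    (b - tensor_map h (idS S) f (idM N1) a')).
  rewrite linearB -aE -a'E.
  rewrite (tensor_map_comp h (idS S) f idfun f idfun q q) //.
  by rewrite (tensor_map_comp h (idS S) idfun f f q idfun q) // subrr.
apply/(tensor_right_exact sp kp); exists b'.
apply: (flatC _ _ i inj_i); rewrite -bE.
rewrite (tensor_map_comp h (idS S) k idfun k idfun i i) //.
rewrite -(tensor_map_comp h (idS S) idfun k k i idfun i) //.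
rewrite b'E linearB tensor_map_comp0 ?subr0 //.
Qed.
End ExactTransfer.

Section FlatRetract.
Variables (S R : comPzRingType) (h : {rmorphism S -> R}).
Lemma flat_retract (M M' : lmodType R) (i : {linear M' -> M}) (r : {linear M -> M'}) :
  cancel i r -> flat_over h M -> flat_over h M'.
Proof.
move=> iK flatM N N1 k inj_k x y /(congr1 (tensor_map h (idS S) i (idM N1))).
rewrite !(tensor_map_comp h (idS S) idfun i i k idfun k) //.
rewrite -!(tensor_map_comp h (idS S) i idfun i idfun k k) //.
move=> /(flatM _ _ k inj_k) /(congr1 (tensor_map h (idS S) r (idM N))).
by rewrite !(tensor_map_comp h (idS S) i r idfun idfun idfun idfun) //
  !tensor_map_id.
Qed.
End FlatRetract.

Section BaseDualLinear.
Variables (S R S' : comPzRingType) (h : {rmorphism S -> R}) (g : {rmorphism S -> S'}).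

(** The base change of [R] and the ring R ⊗_S S' over itself have the same carrier but are different
    module instances; the identity maps relate them. *)
Lemma flat_hom_base : flat_hom h -> flat_hom (base_hom h g).
Proof.
move=> flatR; have := @flat_base _ _ _ _ g _ flatR.
have lid : linear (fun x : (base_ring h g)^o => x : base_module h g R^o) by [].
have lid' : linear (fun x : base_module h g R^o => x : (base_ring h g)^o) by [].
by apply: (@flat_retract _ _ _ _ _ (mklin lid) (mklin lid')).
Qed.

Lemma base_dual_linear (P : lmodType R) :
  linear (fun z : base_module h g (dual P) => base_dual z).
Proof.
move=> c x y; rewrite base_dualD; congr (_ + _).
move: x; apply: additive_ext => [||x x'|x x'|phi t].
- by rewrite [X in base_dual X]scaler0 base_dual0.
- by rewrite base_dual0 scaler0.
- by rewrite [X in base_dual X]scalerDr base_dualD.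
- by rewrite base_dualD scalerDr.
move: c; apply: (@additive_ext S R S' h g R^o S'^o) => [||a b|a b|r s].
- by rewrite scale0r base_dual0.
- by rewrite scale0r.
- by rewrite [X in base_dual X]scalerDl base_dualD.
- by rewrite scalerDl.
rewrite [X in base_dual X]scale_pure !base_dual_pure scalerA mulrC -scalerA.
rewrite [X in _ = _ *: X]base_functionalZ scalerA -rmorphM.
by congr (base_hom h g _ *: _); exact: mulrC.
Qed.

Section Complexes.
Variable E : cochain_complex R.
Hypothesis fpE : fin_proj_complex E.

Lemma fin_proj_complex_base : fin_proj_complex (base_complex h g E).
Proof. by move=> i; exact: fin_proj_base. Qed.

Lemma base_dual_complex_exact i :
  exact_deg (base_complex h g (dual_complex E)) i <->
  exact_deg (dual_complex (base_complex h g E)) i.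
Proof.
have dualP (a b : int) := base_dual_exact h g (cdiff E (1 - b) (1 - i))
  (cdiff E (1 - i) (1 - a)) (fpE _) (fpE _) (fpE _).
split=> ex a b ai ib; first exact: (iffLR (dualP a b) (ex a b ai ib)).
exact: (iffRL (dualP a b) (ex a b ai ib)).
Qed.
End Complexes.
End BaseDualLinear.

Definition uexact_deg (S R : comPzRingType) (h : {rmorphism S -> R})
    (E : cochain_complex R) (j : int) : Prop :=
  forall a b, a + 1 = j -> j + 1 = b -> uexact h (cdiff E a j) (cdiff E j b).

(** The form of relative stable reflexivity that passes to every base change;
    [universally_stable_of_fibres] derives it from the fibres. *)
Definition universally_stable (S R : comPzRingType) (h : {rmorphism S -> R}) (n : nat)
    (E : cochain_complex R) : Prop :=
  fin_proj_complex E /\ forall i, i <= n%:Z ->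
    uexact_deg h E i /\ uexact_deg h (dual_complex E) i.

Section UniversalBase.
Variables (S R S' : comPzRingType) (h : {rmorphism S -> R}) (g : {rmorphism S -> S'}).
Variables (E : cochain_complex R) (n : nat).

Lemma uexact_deg_exact j : uexact_deg h E j -> exact_deg (base_complex h g E) j.
Proof. by move=> ex a b aj jb; exact: (uexact_exact (ex a b aj jb)). Qed.

Lemma uexact_deg_base j :
  uexact_deg h E j -> uexact_deg (base_hom h g) (base_complex h g E) j.
Proof. by move=> ex a b aj jb; exact/uexact_base/ex. Qed.

Lemma uexact_deg_dual_base j : fin_proj_complex E ->
  uexact_deg (base_hom h g) (base_complex h g (dual_complex E)) j ->
  uexact_deg (base_hom h g) (dual_complex (base_complex h g E)) j.
Proof.
move=> fpE ex a b aj jb.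
have bij i : injective (@base_dual _ _ _ h g (cobj E i)) /\
    surjective (@base_dual _ _ _ h g (cobj E i)).
  by have /fin_projP[? [? [? bE]]] := fpE i; exact: base_dual_bij bE.
pose u i := mklin (@base_dual_linear _ _ _ h g (cobj E (1 - i))).
refine (@uexact_iso _ _ _ _ _ _ _ _ _ _ _ _ _ (u a) (u j) (u b)
  _ _ _ _ _ _ (ex a b aj jb)).
- exact: (bij _).1.
- exact: (bij _).2.
- exact: (bij _).1.
- exact: (bij _).2.
- by move=> x; exact/esym/base_dual_nat.
- by move=> x; exact/esym/base_dual_nat.
Qed.

Lemma universally_stable_base : universally_stable h n E ->
  universally_stable (base_hom h g) n (base_complex h g E).
Proof.
move=> [fpE exE]; split=> [|i /exE[ex dex]]; first exact: fin_proj_complex_base.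
split; first exact: uexact_deg_base.
apply: uexact_deg_dual_base => // a b ai ib; exact/uexact_base/dex.
Qed.

Lemma universally_stable_complex : universally_stable h n E ->
  stably_reflexive_complex n (base_complex h g E).
Proof.
move=> [fpE exE]; split=> [|i /exE[ex dex]]; first exact: fin_proj_complex_base.
split; apply/cohomology_eq0P; first exact: uexact_deg_exact.
apply: (iffLR (base_dual_complex_exact h g fpE i)) => a b ai ib.
exact: (uexact_exact (dex a b ai ib)).
Qed.

Lemma hull_base (M : lmodType R) :
  hull E M -> hull (base_complex h g E) (base_module h g M).
Proof.
move=> /hullP[fpE [p [sp kp]]]; apply/hullP; split; first exact: fin_proj_complex_base.
exists (tensor_map h g p (idM S'^o)); split; first exact: tensor_surj.
exact: tensor_right_exact.
Qed.
End UniversalBase.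

(** * From the fibres of a complex to its universal exactness *)

Section Fibres.
Variables (S R : comPzRingType) (h : {rmorphism S -> R}).
Hypothesis flat_h : flat_hom h.

Lemma uexact_deg_of_fibres (F : cochain_complex R) j :
  noetherian S -> coherent_ring R -> fin_proj_complex F ->
  (forall s, closed_image h s -> exact_deg (fiber_complex h s F) j) ->
  uexact_deg h F j.
Proof.
move=> noethS cohR fpF ex a b aj jb.
apply: uexact_of_exact_mod; first by move=> x; exact: cdiff_sq.
  exact: fin_proj_flat.
apply: all_exact_mod_of_fibres => //; first by move=> x; exact: cdiff_sq.
by move=> s /ex; exact.
Qed.

(** Descending induction by dimension shifting with [uexact_pred]. *)
Lemma uexact_deg_down (F : cochain_complex R) (i j : int) :
  fin_proj_complex F -> uexact_deg h F i ->
  (forall l, l < i -> exact_deg F l) -> j <= i -> uexact_deg h F j.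
Proof.
move=> fpF exi ex ji; have [d ->] : exists d : nat, j = i - d%:Z.
  by exists `|i - j|%N; lia.
elim: d {ji} => [|d IHd]; first by rewrite subr0.
move=> a b aj jb; have {}jb : b = i - d%:Z by lia.
apply: (@uexact_pred _ _ h _ _ _ _ _ _ _ _ (cdiff F b (b + 1))).
- by move=> x; exact: cdiff_sq.
- exact: fin_proj_flat.
- exact: fin_proj_flat.
- by move=> x; exact: cdiff_sq.
- by apply: ex; lia.
- by rewrite jb; apply: IHd; lia.
Qed.

Lemma universally_stable_of_fibres n (E : cochain_complex R) :
  noetherian S -> coherent_ring R ->
  stably_reflexive_complex_wrt h n E -> universally_stable h n E.
Proof.
move=> noethS cohR [_ fpE exE]; split=> // i iltn.
split.
  apply: uexact_deg_of_fibres => // s /exE[_ /(_ i iltn)[ex _]].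
  exact/cohomology_eq0P.
apply: uexact_deg_of_fibres => // [j|s]; first exact: fin_proj_dual.
move=> /exE[_ /(_ i iltn)[_ ex]].
apply: (iffRL (base_dual_complex_exact h (residue_map s) fpE i)).
exact/cohomology_eq0P.
Qed.
End Fibres.

(** * Relative stable reflexivity of a module and of its hull *)

Theorem proposition4p3 (S R : comPzRingType) (h : {rmorphism S -> R})
    (M : lmodType R) (n : nat) :
  flat_hom h -> coherent M -> coherent_ring R -> noetherian S -> (1 < n)%N ->
  (exists E : cochain_complex R,
     [/\ fin_proj_complex E, hull E M
       & stably_reflexive_wrt h n M -> stably_reflexive_complex_wrt h n E])
  /\
  (forall E : cochain_complex R,
     stably_reflexive_complex_wrt h n E -> hull E M ->
     stably_reflexive_wrt h n M /\
     (forall (S' : comPzRingType) (g : {rmorphism S -> S'}),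
        [/\ stably_reflexive_complex_wrt (base_hom h g) n (base_complex h g E),
            stably_reflexive_complex n (base_complex h g E)
          & hull (base_complex h g E) (base_module h g M)])).
Proof.
move=> flat_h cohM cohR noethS n_gt1; split.
  have [E [hullE exE dexE]] := free_hull cohR cohM.
  have [fpE [p [sp kp]]] := iffLR (hullP _ _) hullE.
  exists E; split=> // -[_ flatM reflM]; split=> // s cls.
  (* Dimension shifting starts at the augmentation: [M] is flat, and the sequence from degree -1
     through degree 0 to [M] is universally exact by right exactness. *)
  have uexE j : j <= -1 -> uexact_deg h E j.
    apply: (uexact_deg_down flat_h fpE) => [a b a0 b0|l lneg]; last by apply: exE; lia.
    have {}b0 : b = 0 by rewrite -b0.
    subst b; apply: (@uexact_pred _ _ h _ _ _ _ _ _ _ _ p) => //.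
    + by move=> x; exact: cdiff_sq.
    + exact: fin_proj_flat.
    + by move=> x; apply/kp; exists x.
    + exact: exE.
    + by move=> N x; apply: (iffLR (tensor_right_exact sp kp x)).
  have exEs t j : j <= -1 -> exact_deg (fiber_complex h t E) j.
    by move=> jneg; exact/uexact_deg_exact/uexE.
  (* Degree 2 of the dual complex sits at degree -1 of [E]; on the fibres it is Ext^1(M_s, R_s),
     which vanishes because n > 1. *)
  have udexE j : j <= 2%:Z -> uexact_deg h (dual_complex E) j.
    apply: (uexact_deg_down flat_h); first by move=> i; exact: fin_proj_dual.
      apply: uexact_deg_of_fibres => //; first by move=> i; exact: fin_proj_dual.
      move=> t clt; apply/(iffRL (base_dual_complex_exact h (residue_map t) fpE 2%:Z)).
      apply/cohomology_eq0P.
      apply: (iffRL (@dual_cohomology_eq0P _ (fiber_complex h t E) 2%:Z (-1) erefl)).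
      have [_ /(_ 1%N n_gt1)[ExtM _]] := reflM t clt.
      exact: (iffLR (dual_exact_of_Ext (hull_base h (residue_map t) hullE)
        (exEs t) (isT : (0 < 1)%N)) ExtM).
    (* Below degree 2 the dual complex is exact over [R] by construction, since 1 - l is
       nonnegative. *)
    move=> l l2; apply/cohomology_eq0P.
    by apply: (iffRL (@dual_cohomology_eq0P _ E l _ erefl)); apply: dexE; lia.
  apply: (complex_of_stably_reflexive (hull_base h (residue_map s) hullE)
    _ (exEs s) _ (reflM s cls)).
    exact: ltnW.
  move=> j jpos; have ij : 1 - (1 - j) = j by lia.
  apply: (iffLR (dual_cohomology_eq0P (fiber_complex h s E) ij)).
  apply/cohomology_eq0P.
  apply: (iffLR (base_dual_complex_exact h (residue_map s) fpE (1 - j))).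
  apply: uexact_deg_exact.
  by apply: udexE; lia.
move=> E stE hullE; have usE := universally_stable_of_fibres flat_h noethS cohR stE.
have [fpE [p [sp kp]]] := iffLR (hullP _ _) hullE.
split.
  split=> // [|s cls].
    (* Degrees -2, -1 and 0 followed by [M]: universal exactness in degree -1 gives the flatness of
       [M]. *)
    apply: (flat_of_uexact (f := cdiff E (- 2%:Z) (-1)) _ _ sp kp).
    - exact: fin_proj_flat.
    - by move=> x; exact: cdiff_sq.
    - by have [_ /(_ (-1) isT)[ex _]] := usE; exact: ex.
  apply: (stably_reflexive_of_complex (hull_base h (residue_map s) hullE)).
    exact: ltnW.
  by case: stE => _ _; exact.
move=> S' g; split.
- split=> [||s cls]; [exact: flat_hom_base | exact: fin_proj_complex_base |].
  (* Universal exactness passes to [S'], and from there to the fibres over [S']. *)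
  exact/universally_stable_complex/universally_stable_base.
- exact: universally_stable_complex.
- exact: hull_base.
Qed.
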